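(* Let $\ell\ge1$, let $q_1,\dots,q_\ell\ge1$ be pairwise co-prime natural numbers and let $k>1$ be an integer. Let $\mathbf{K}\subset\mathbb{C}$ be a number field such that $\mathbf{K}\cap\mathbb{Q}(\zeta_{q_1\cdots q_\ell})^{+}=\mathbb{Q}$. Then $$\dim_{\mathbf{K}}\Big(\sum_{j=1}^{\ell}V^+_{\mathbf{K},k}(q_j)\Big)=\sum_{j=1}^{\ell}\dim_{\mathbf{K}}\big(V^+_{\mathbf{K},k}(q_j)\big)-(\ell-1)\dim_{\mathbf{K}}\big(V^+_{\mathbf{K},k}(1)\big).$$ In particular, $$\dim_{\mathbf{K}}\Big(\sum_{j=1}^{\ell}V^+_{\mathbf{K},k}(q_j)\Big)=\begin{cases}\sum_{j=1}^{\ell}\frac{\varphi(q_j)}{2}-\frac{\ell-1}{2}(1+(-1)^k) & \text{if } 2<q_1,\dots,q_\ell,\\[1mm] \sum_{j=2}^{\ell}\frac{\varphi(q_j)}{2}-\frac{\ell-2}{2}(1+(-1)^k) & \text{if } 2=q_1<q_2,\dots,q_\ell.\end{cases}$$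
   Context: $\zeta_n$ is a primitive $n$-th root of unity, $\mathbb{Q}(\zeta_n)^+=\mathbb{Q}(\zeta_n)\cap\mathbb{R}$, and $\varphi$ is Euler's totient function. The Hurwitz zeta function is $\zeta(s,x)=\sum_{n\ge0}(n+x)^{-s}$ for $0<x\le1$, $\Re(s)>1$; note $\zeta(k,1)=\zeta(k)$. For a number field $\mathbf{K}\subset\mathbb{C}$ and integers $k>1$, $q>2$, $$V^{+}_{\mathbf{K},k}(q)=\sum_{1\le a<q/2,\ (a,q)=1}\mathbf{K}\big(\zeta(k,a/q)+(-1)^k\zeta(k,1-a/q)\big)\subset\mathbb{C},$$ while $V^{+}_{\mathbf{K},k}(2)=\mathbf{K}\,\zeta(k,1/2)(1+(-1)^k)$ and $V^{+}_{\mathbf{K},k}(1)=\mathbf{K}\,\zeta(k,1)(1+(-1)^k)$. *)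

(* Defs.v *)
From HB Require Import structures.
From mathcomp Require Import all_boot all_order all_algebra.
From mathcomp Require Import boolp classical_sets reals topology normedtype sequences.
From mathcomp Require Import complex.

Set Implicit Arguments.
Unset Strict Implicit.
Unset Printing Implicit Defensive.

Import Order.TTheory GRing.Theory Num.Theory numFieldNormedType.Exports.
Local Open Scope ring_scope.

Section Defs.
Variable R : realType.
Local Notation C := R[i].

Definition hurwitz_zeta (k : nat) (x : R) : R :=
  limn (series (fun n : nat => (n%:R + x) ^- k)).

Definition RtoC (x : R) : C := Complex x 0.

(* generators of V^+_{K,k}(q) as a K-vector space *)
Definition Vgens (k q : nat) : seq C :=
  if (2 < q)%N then
    [seq RtoC (hurwitz_zeta k (a%:R / q%:R)
               + (-1) ^+ k * hurwitz_zeta k (1 - a%:R / q%:R))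
    | a <- iota 1 q & ((a.*2 < q)%N && coprime a q)]
  else if q == 2%N then [:: RtoC (hurwitz_zeta k (1 / 2) * (1 + (-1) ^+ k))]
  else [:: RtoC (hurwitz_zeta k 1 * (1 + (-1) ^+ k))].

Definition indepK (K : {pred C}) (s : seq C) : Prop :=
  forall c : seq C, size c = size s -> all (fun x => x \in K) c ->
    \sum_(i < size s) c`_i * s`_i = 0 -> forall i, c`_i = 0.

(* dim_K of the K-span of the elements of s: the maximal size of a
   K-linearly independent subfamily of s *)
Definition dimK (K : {pred C}) (s : seq C) : nat :=
  \max_(m : (size s).-tuple bool | `[< indepK K (mask m s) >]) count id m.

Definition number_field (K : {pred C}) : Prop :=
  [/\ 0 \in K, 1 \in K,
      {in K &, forall x y, x + y \in K}, {in K, forall x, - x \in K} &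
      {in K &, forall x y, x * y \in K}] /\ {in K, forall x, x^-1 \in K} /\
      exists b : seq C, forall x, x \in K ->
        exists r : seq rat, size r = size b /\ x = \sum_(i < size b) ratr r`_i * b`_i.

Definition cyclo_field (N : nat) (x : C) : Prop :=
  exists z : C, N.-primitive_root z /\ exists p : {poly rat}, x = (map_poly ratr p).[z].

Definition cyclo_plus (N : nat) (x : C) : Prop := cyclo_field N x /\ x \is Num.real.

Definition meets_cyclo_plus_in_Q (K : {pred C}) (N : nat) : Prop :=
  forall x, x \in K -> cyclo_plus N x -> exists r : rat, x = ratr r.

End Defs.

(* Main.v *)
Require Import Defs.
From HB Require Import structures.
From mathcomp Require Import all_boot all_order all_algebra all_field.
From mathcomp Require Import boolp classical_sets reals topology normedtype sequences.
From mathcomp Require Import realfun derive trigo.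
From mathcomp Require Import complex ring lra zify.
Set Implicit Arguments.
Unset Strict Implicit.
Unset Printing Implicit Defensive.
Import Order.TTheory GRing.Theory Num.Theory numFieldNormedType.Exports.
Local Open Scope classical_set_scope.
Local Open Scope ring_scope.

(** Put g(x) = zeta(k,x) + (-1)^k zeta(k,1-x).  Herglotz's duplication argument
    identifies g(x) with pi^k Q(cot pi x) for a rational polynomial Q, so that, up
    to a common factor, the numbers g(a/q_j) lie in F = Q(zeta_N)^+, N = q_1...q_l.
    As K meets F in Q, the minimal polynomial of 2 cos(2 pi/N) over K has rational
    coefficients; hence a K-linear relation between the g(a/q_j) remains true after
    replacing a by ba, for every b prime to N.  By the Chinese remainder theorem
    each block of such a relation, as a function of b mod q_j, is constant.
    The operator c |-> (b |-> sum_a c(a) g(ba/q)) is a multiple of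
    sum_n n^-k [n], which is 1 plus an operator of norm at most zeta(k) - 1 < 1, so
    it is injective.  Thus each block of coefficients is constant, and is zero for
    odd k.  For even k the block sums are rational multiples of zeta(k), which gives
    exactly l - 1 independent relations. *)

(** * The Hurwitz zeta function at integers *)

(** All blocks share the exponent k, hence the transcendental factor pi^k; a linear relation is
    homogeneous, so this factor cancels before any conjugation. The hypothesis controls only the
    intersection of K with F, so no automorphism of a field containing both is invoked: a relation
    is read as a polynomial over K at 2 cos(2 pi/N), and conjugating it means evaluating at 2 cos(2
    pi b/N). Every value, and every inverse occurring in it, must therefore come from one explicit
    rational polynomial in that cosine. For odd k an odd power of a cotangent remains, which is
    first multiplied by a sine common to all terms. Taking b congruent to 1 modulo the other q_i
    freezes the other blocks; this is where co-primality enters. For odd k, b and -b give opposite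
    values, so the constant is 0; for even k it is also produced by equal coefficients. Injectivity
    of the zeta operator plays the part usually given to the nonvanishing of L(k, chi), without
    characters. *)

Section Hurwitz.
Variables (R : realType) (k : nat).
Hypothesis k_gt1 : (1 < k)%N.
Implicit Types x y : R.

Local Notation term x := (fun n : nat => (n%:R + x) ^- k).

Lemma hterm_gt0 x n : 0 < x -> 0 < (n%:R + x) ^- k.
Proof. by move=> x0; rewrite invr_gt0 exprn_gt0 // ltr_wpDl. Qed.

Lemma hterm_anti x y n : 0 < x -> x <= y -> (n%:R + y) ^- k <= (n%:R + x) ^- k.
Proof.
move=> x0 xy; have y0 := lt_le_trans x0 xy.
rewrite lef_pV2 ?posrE ?exprn_gt0 ?ltr_wpDl //.
by apply: lerXn2r; rewrite ?lerD2l // nnegrE addr_ge0 // ltW.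
Qed.

(* Telescoping against 1/(n (n+1)); the constant 7/4 < 2 is what makes the
   unit term dominate the tail of zeta(k). *)
Lemma zeta_partial_le m :
  \sum_(0 <= n < m.+2) (n%:R + 1) ^- k <= 7%:R / 4%:R - m.+2%:R^-1 :> R.
Proof.
have sq n : (n%:R + 1) ^- k <= ((n%:R + 1) ^+ 2)^-1 :> R.
  rewrite lef_pV2 ?posrE ?exprn_gt0 ?ltr_wpDl //.
  by rewrite ler_weXn2l // lerDr.
elim: m => [|m IH].
  rewrite !big_nat_recr //= big_nil add0r.
  have := sq 1%N; have := sq 0%N; rewrite !add0r !expr1n invr1.
  have -> : ((1%:R + 1) ^+ 2)^-1 = 1 / 4%:R :> R by field.
  have -> : 2%:R^-1 = 1 / 2%:R :> R by field.
  by lra.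
rewrite big_nat_recr //=.
apply: le_trans (lerD IH (sq _)) _.
rewrite -[m.+3%:R]natr1 -[m.+2%:R]natr1 -[m.+1%:R]natr1.
set t : R := m%:R; have t0 : 0 <= t by exact: ler0n.
rewrite -subr_ge0.
have -> : 7%:R / 4%:R - (t + 1 + 1 + 1)^-1 -
  (7%:R / 4%:R - (t + 1 + 1)^-1 + (t + 1 + 1 + 1) ^- 2)
  = ((t + 1 + 1) * (t + 1 + 1 + 1) ^+ 2)^-1.
  by field; rewrite !gt_eqF //; lra.
by rewrite invr_ge0 mulr_ge0 ?exprn_ge0 //; lra.
Qed.

Lemma hurwitz_series_nd x : 0 < x -> nondecreasing_seq (series (term x)).
Proof.
move=> x0; apply/nondecreasing_seqP => n; rewrite /series /= big_nat_recr //=.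
by rewrite lerDl ltW // hterm_gt0.
Qed.

Lemma hurwitz_series_le x m : 0 < x ->
  series (term x) m <= x ^- k + 7%:R / 4%:R.
Proof.
move=> x0; apply: (@le_trans _ _ (series (term x) m.+3)).
  by apply: hurwitz_series_nd => //; rewrite -addn3 leq_addr.
rewrite /series /= big_nat_recl //= add0r lerD2l.
apply: (@le_trans _ _ (\sum_(0 <= n < m.+2) (n%:R + 1) ^- k)).
  apply: ler_sum => n _; rewrite -natr1 -addrA.
  by apply: hterm_anti; rewrite // lerDl ltW.
apply: le_trans (zeta_partial_le _) _.
by rewrite gerBl invr_ge0 ler0n.
Qed.

Lemma is_cvg_hurwitz x : 0 < x -> cvgn (series (term x)).
Proof.
move=> x0; apply: nondecreasing_is_cvgn; first exact: hurwitz_series_nd.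
exists (x ^- k + 7%:R / 4%:R) => _ [m _ <-]; exact: hurwitz_series_le.
Qed.

Lemma cvg_hurwitz x : 0 < x ->
  series (term x) n @[n --> \oo] --> hurwitz_zeta k x.
Proof. by move=> x0; apply/cvg_ex; exists (hurwitz_zeta k x); apply: is_cvg_hurwitz. Qed.

Lemma hurwitz_zetaS x : 0 < x ->
  hurwitz_zeta k x = x ^- k + hurwitz_zeta k (x + 1).
Proof.
move=> x0; have x10 : 0 < x + 1 by rewrite ltr_wpDr.
have h1 : series (term x) n.+1 @[n --> \oo] --> hurwitz_zeta k x.
  by rewrite cvg_shiftS; apply: cvg_hurwitz.
have h2 : series (term x) n.+1 @[n --> \oo] --> x ^- k + hurwitz_zeta k (x + 1).
  have -> : (fun n => series (term x) n.+1) =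
    (fun n => x ^- k + series (term (x + 1)) n).
    apply/funext => n; rewrite /series /= big_nat_recl //= add0r; congr (_ + _).
    by apply: eq_bigr => i _; rewrite -natr1 -addrA [1 + _]addrC.
  by apply: cvgD; [exact: cvg_cst | exact: cvg_hurwitz].
exact: (cvg_unique _ h1 h2).
Qed.

Lemma hurwitz_zeta_ge0 x : 0 < x -> 0 <= hurwitz_zeta k x.
Proof.
move=> x0; apply: limr_ge; first exact: is_cvg_hurwitz.
by apply: nearW => n; apply: sumr_ge0 => i _; rewrite ltW // hterm_gt0.
Qed.

Lemma hurwitz_zeta_geV x : 0 < x -> x ^- k <= hurwitz_zeta k x.
Proof.
by move=> x0; rewrite hurwitz_zetaS // lerDl hurwitz_zeta_ge0 // ltr_wpDr.
Qed.

Lemma hurwitz_zeta_gt0 x : 0 < x -> 0 < hurwitz_zeta k x.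
Proof.
move=> x0; apply: lt_le_trans (hurwitz_zeta_geV x0).
by rewrite invr_gt0 exprn_gt0.
Qed.

Lemma hurwitz_zeta_anti x y : 0 < x -> x <= y ->
  hurwitz_zeta k y <= hurwitz_zeta k x.
Proof.
move=> x0 xy; have y0 := lt_le_trans x0 xy.
apply: ler_lim; [exact: is_cvg_hurwitz | exact: is_cvg_hurwitz | ].
apply: nearW => n; apply: ler_sum => i _; exact: hterm_anti.
Qed.

Lemma zeta_lt2 : hurwitz_zeta k 1 < 2 :> R.
Proof.
suff : hurwitz_zeta k 1 <= 7%:R / 4%:R :> R by lra.
apply: limr_le; first exact: is_cvg_hurwitz.
apply: nearW => m.
apply: (@le_trans _ _ (series (term 1) m.+2)).
  by apply: hurwitz_series_nd => //; rewrite -addn2 leq_addr.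
apply: le_trans (zeta_partial_le _) _.
by rewrite gerBl invr_ge0 ler0n.
Qed.

(** Writing the summation index as [j * M + i] with i < M groups the series at x into blocks of M
    terms, and i selects the shifted argument. M = 2 feeds the duplication step, general M the sums
    over residues. *)
Lemma hurwitz_zeta_distr M x : (0 < M)%N -> 0 < x ->
  \sum_(i < M) hurwitz_zeta k ((x + i%:R) / M%:R) = M%:R ^+ k * hurwitz_zeta k x.
Proof.
move=> M0 x0; have M0R : 0 < M%:R :> R by rewrite ltr0n.
have h1 : \sum_(i < M) series (term ((x + i%:R) / M%:R)) n @[n --> \oo]
   --> \sum_(i < M) hurwitz_zeta k ((x + i%:R) / M%:R).
  apply: cvg_big => [|i _]; first exact: add_continuous.
  by apply: cvg_hurwitz; rewrite divr_gt0 // ltr_wpDr.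
have h2 : \sum_(i < M) series (term ((x + i%:R) / M%:R)) n @[n --> \oo]
   --> M%:R ^+ k * hurwitz_zeta k x.
  have -> : (fun n => \sum_(i < M) series (term ((x + i%:R) / M%:R)) n) =
     (fun n => M%:R ^+ k * series (fun m => \sum_(m * M <= i < m.+1 * M) (i%:R + x) ^- k) n).
    apply/funext => n.
    rewrite /series /= exchange_big mulr_sumr; apply: eq_bigr => j _.
    rewrite -{1}[(j * M)%N]add0n big_addn mulSn addnK big_mkord mulr_sumr.
    apply: eq_bigr => i _; rewrite -[in LHS]exprVn -[in RHS]exprVn -exprMn; congr (_ ^+ _).
    rewrite natrD natrM; field.
    have p1 : 0 < j%:R * M%:R + (x + i%:R) by rewrite ltr_wpDl ?mulr_ge0 // ltr_wpDr.
    by apply/andP; split; rewrite gt_eqF // [i%:R + _]addrC -addrA [i%:R + x]addrC.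
  exact: cvgMl_tmp (cvg_series_cvg_series_group (is_cvg_hurwitz x0) M0).
exact: (cvg_unique _ h1 h2).
Qed.

End Hurwitz.

(** * Derivatives of the cotangent *)

(* [cotp n] is the polynomial q with (-1)^n/n! (d/dt)^n cot t = q (cot t). *)
Fixpoint cotp (n : nat) : {poly rat} :=
  if n is m.+1 then m.+1%:R^-1 *: ((1 + 'X^2) * (cotp m)^`()) else 'X.

(** After removal of at most one factor X only even powers remain, so values at a cotangent are
    governed by its square, which lies in the real cyclotomic field. *)
Lemma cotp_parity n : exists r : {poly rat},
  cotp n = 'X^(odd n.+1) * (r \Po 'X^2).
Proof.
elim: n => [|n [r IH]]; first by exists 1; rewrite comp_polyC mulr1.
rewrite /= IH /=; case: (odd n) => /=.
  exists (n.+1%:R^-1 *: ((1 + 'X) * (2%:R *: r^`()))).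
  rewrite expr0 mul1r deriv_comp derivXn /= expr1.
  rewrite !(comp_polyZ, comp_polyM, comp_polyD, comp_polyX, comp_polyC, rmorph1).
  rewrite -!mul_polyC; ring.
exists (n.+1%:R^-1 *: ((1 + 'X) * (r + 2%:R *: ('X * r^`())))).
rewrite derivM derivXn deriv_comp derivXn /= expr0 expr1.
rewrite !(comp_polyZ, comp_polyM, comp_polyD, comp_polyX, comp_polyC, rmorph1).
rewrite -!mul_polyC; ring.
Qed.

(** The factor 1/(n+1) in [cotp] cancels the exponent brought down by the derivative, so the
    polynomial stays monic of degree n+1. Its top term then matches the pole x^-k of the zeta value
    with coefficient exactly 1. *)
Lemma cotp_lead n : exists2 p : {poly rat},
  (size p <= n.+1)%N & cotp n = 'X^(n.+1) + p.
Proof.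
elim: n => [|n [p sp IH]]; first by exists 0; rewrite ?size_poly0 // addr0.
exists ('X^n + n.+1%:R^-1 *: ((1 + 'X^2) * p^`())).
  apply: leq_trans (size_polyD _ _) _; rewrite geq_max size_polyXn leqnSn /=.
  apply: leq_trans (size_scale_leq _ _) _.
  apply: leq_trans (size_polyMleq _ _) _.
  have s2 : (size (1 + 'X^2 : {poly rat})%R <= 3)%N.
    apply: leq_trans (size_polyD _ _) _; by rewrite size_poly1 size_polyXn.
  apply: (@leq_trans (3 + size p^`()).-1); first by rewrite -!subn1 leq_sub2r // leq_add2r.
  have [->|p0] := eqVneq p 0; first by rewrite deriv0 size_poly0.
  by rewrite !addSn /= ltnS; apply: leq_trans (lt_size_deriv p0) sp.
rewrite /= IH derivD derivXn /= -!mul_polyC.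
have e : (n.+1%:R^-1)%:P * n.+1%:R = 1 :> {poly rat}.
  by rewrite -polyC_natr -polyCM mulVf ?pnatr_eq0.
rewrite -['X^n *+ n.+1]mulr_natr [in RHS]exprS [X in _ * X + _]exprS.
move: e; set u := (_^-1)%:P; set v := n.+1%:R => e.
transitivity (u * v * 'X^n * (1 + 'X^2) + u * ((1 + 'X^2) * p^`())); first by ring.
by rewrite e; ring.
Qed.

Section CotReal.
Variable R : realType.
Implicit Types x y c : R.

Definition cotR n : {poly R} := map_poly ratr (cotp n).

Lemma cotR0 : cotR 0 = 'X. Proof. by rewrite /cotR /= map_polyX. Qed.

Lemma cotRS n y : (cotR n.+1).[y] = n.+1%:R^-1 * ((1 + y ^+ 2) * (cotR n)^`().[y]).
Proof.
rewrite /cotR /= map_polyZ /= hornerZ rmorphM rmorphD rmorph1 /= map_polyXn.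
by rewrite fmorphV /= ratr_nat !hornerE deriv_map.
Qed.

Lemma cotRN n y : (cotR n).[- y] = (-1) ^+ n.+1 * (cotR n).[y].
Proof.
rewrite /cotR; have [r ->] := cotp_parity n.
rewrite rmorphM /= map_polyXn map_comp_poly map_polyXn !hornerM !horner_comp.
rewrite !hornerXn sqrrN mulrA; congr (_ * _).
by rewrite -signr_odd /=; case: (odd n) => /=; rewrite ?expr0 ?expr1 ?mulr1 ?mulN1r.
Qed.

(** For c = cot(t/2) the three arguments are cot(t/2), cot(t/2 + pi/2) and cot t. The induction
    differentiates the identity with respect to c itself, so no trigonometry enters. *)
Lemma cotR_double n c : c != 0 ->
  (cotR n).[c] + (cotR n).[- c^-1] = 2 ^+ n.+1 * (cotR n).[(c - c^-1) / 2].
Proof.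
elim: n c => [|n IH] c c0.
  by rewrite cotR0 !hornerX expr1; field.
pose q := cotR n.
pose L : R -> R := fun y => q.[y] + q.[- y^-1].
pose D : R -> R := fun y => 2 ^+ n.+1 * q.[(y - y^-1) / 2].
have LD : \forall y \near c, L y = D y.
  near=> y; apply: IH; near: y.
  by apply: (@cvgr_neq0 _ _ _ _ _ id c) => //; exact: cvg_id.
have dV : is_derive c 1 (fun y : R => y^-1) (- c ^- 2).
  by apply: is_derive_eq (is_deriveV c0 (is_derive_id c 1)) _; rewrite /GRing.scale /= mulr1.
have dN : is_derive c 1 (fun y : R => - y^-1) (c ^- 2).
  by apply: is_derive_eq (is_deriveN dV) _; rewrite opprK.
have dH : is_derive c 1 (fun y : R => (y - y^-1) / 2) ((1 + c ^- 2) / 2).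
  have -> : (fun y : R => (y - y^-1) / 2) = 2^-1 \*: (fun y : R => y - y^-1).
    by apply/funext => y /=; rewrite mulrC.
  by apply: is_derive_eq (is_deriveZ _ (is_deriveB (is_derive_id c 1) dV)) _;
    rewrite /GRing.scale /= opprK mulrC.
have dL : is_derive c 1 L (q^`().[c] + q^`().[- c^-1] * c ^- 2).
  by apply: is_deriveD; exact: is_derive1_comp.
have dD : is_derive c 1 D (2 ^+ n.+1 * (q^`().[(c - c^-1) / 2] * ((1 + c ^- 2) / 2))).
  by apply: is_deriveZ; exact: is_derive1_comp.
have := @near_eq_derive R R R L D c 1 LD.
rewrite (@derive_val _ _ _ _ _ _ _ dL) (@derive_val _ _ _ _ _ _ _ dD).
rewrite !cotRS -/q; set a := q^`().[c]; set b := q^`().[_]; set d := q^`().[_] => e.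
(* The factor 1 + y^2 of the recursion, taken at the doubled argument, is a quarter of the product
   of its values at c and at -1/c. *)
have -> : (1 + ((c - c^-1) / 2) ^+ 2) = (1 + c ^+ 2) * (1 + c ^- 2) / 4%:R by field.
move: (n.+1%:R^-1) => N.
transitivity (N * (1 + c ^+ 2) * (a + b * c ^- 2)).
  by field.
by rewrite e [2 ^+ n.+2]exprS; field.
Unshelve. all: by end_near.
Qed.

(** The weight s^n clears the denominators of the lower terms: (c/s)^i s^n = c^i s^(n-i) has
    absolute value at most 1 for i <= n. *)
Lemma cotR_lower_bound n : exists B : R, forall c s : R,
  `|c| <= 1 -> 0 < s <= 1 -> `|(cotR n).[c / s] - (c / s) ^+ n.+1| * s ^+ n <= B.
Proof.
rewrite /cotR; have [p sp ->] := cotp_lead n.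
exists (\sum_(i < n.+1) `|ratr p`_i|) => c s c1 /andP[s0 s1].
rewrite rmorphD /= map_polyXn hornerD hornerXn addrAC subrr add0r.
rewrite (@horner_coef_wide _ n.+1); last by rewrite size_map_poly.
rewrite -[s ^+ n]gtr0_norm ?exprn_gt0 // -normrM mulr_suml.
apply: le_trans (ler_norm_sum _ _ _) _; apply: ler_sum => i _.
rewrite coef_map /= -mulrA normrM ler_piMr //.
have -> : s ^+ n = s ^+ i * s ^+ (n - i) by rewrite -exprD subnKC // -ltnS.
rewrite mulrA -exprMn divfK ?gt_eqF // normrM !normrX.
rewrite mulr_ile1 ?exprn_ge0 //; first by rewrite exprn_ile1.
by rewrite exprn_ile1 // gtr0_norm.
Qed.

End CotReal.

(** * The partial fraction expansion of the cotangent derivatives *)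

Section Herglotz.
Variable R : realType.
Implicit Types x y t c s : R.

Lemma sin_mvt t : 0 <= t -> exists2 u : R, 0 <= u <= t & sin t = cos u * t.
Proof.
move=> t0; have [|u] := @MVT_segment R sin cos 0 t t0 (fun x _ => is_derive_sin x).
  by apply: continuous_subspaceT; exact: continuous_sin.
by rewrite in_itv /= sin0 !subr0 => ut e; exists u.
Qed.

Lemma sin_le_id t : 0 <= t -> sin t <= t.
Proof.
by move=> t0; have [u _ ->] := sin_mvt t0; rewrite ler_piMl // cos_le1.
Qed.

Lemma mul_cos_le_sin t : 0 <= t <= pi -> t * cos t <= sin t.
Proof.
move=> /andP[t0 tpi]; have [u /andP[u0 ut] ->] := sin_mvt t0.
rewrite mulrC ler_wpM2r //.
have [->//|ne] := eqVneq u t.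
by rewrite ltW // ltr_cos ?in_itv /= ?t0 ?u0 ?(le_trans ut) // lt_neqAle ne.
Qed.

Definition cotpi x := cos (pi * x) / sin (pi * x).

Lemma sinpi_gt0 x : 0 < x < 1 -> 0 < sin (pi * x).
Proof.
move=> /andP[x0 x1]; apply: sin_gt0_pi.
by rewrite mulr_gt0 ?pi_gt0 //= gtr_pMr // pi_gt0.
Qed.

Lemma cospi_half_gt0 x : 0 < x < 1 -> 0 < cos (pi * (x / 2)).
Proof.
move=> /andP[x0 x1]; have p0 := @pi_gt0 R; apply: cos_gt0_pihalf.
by apply/andP; split; nra.
Qed.

Lemma cotpi_double x : 0 < x < 1 ->
  cotpi x = (cotpi (x / 2) - (cotpi (x / 2))^-1) / 2.
Proof.
move=> x01; rewrite /cotpi.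
have c0 := cospi_half_gt0 x01.
have s0 : 0 < sin (pi * (x / 2)) by apply: sinpi_gt0; lra.
have -> : pi * x = (pi * (x / 2)) *+ 2 by rewrite -mulr_natr; field.
rewrite cos_mulr2n sin_mulr2n !mulr2n.
have := cos2Dsin2 (pi * (x / 2)).
move: (cos _) (sin _) c0 s0 => c s c0 s0 e.
have -> : c ^+ 2 + c ^+ 2 - 1 = c ^+ 2 - s ^+ 2 by lra.
have cs0 : 0 < c * s by rewrite mulr_gt0.
by field; rewrite !gt_eqF // addr_gt0.
Qed.

Lemma cotpi_half_shift x : cotpi ((x + 1) / 2) = - (cotpi (x / 2))^-1.
Proof.
rewrite /cotpi; have -> : pi * ((x + 1) / 2) = pi * (x / 2) + pi / 2 by field.
by rewrite cosDpihalf sinDpihalf invf_div mulNr.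
Qed.

Lemma cotpi1B x : cotpi (1 - x) = - cotpi x.
Proof.
rewrite /cotpi mulrBr mulr1 addrC sinDpi cosDpi sinN cosN opprK.
by rewrite mulNr.
Qed.

Lemma cotpiD1 x : cotpi (x + 1) = cotpi x.
Proof.
by rewrite /cotpi mulrDr mulr1 sinDpi cosDpi invrN mulrNN.
Qed.

Lemma sinpi1B x : sin (pi * (1 - x)) = sin (pi * x).
Proof. by rewrite mulrBr mulr1 addrC sinDpi sinN opprK. Qed.

Lemma bernoulli_ile u n : 0 <= u <= 1 -> 1 - u ^+ n <= n%:R * (1 - u) :> R.
Proof.
move=> /andP[u0 u1]; elim: n => [|n IH]; first by rewrite expr0 subrr mul0r.
have h : 0 <= u ^+ n <= 1 by rewrite exprn_ge0 //= exprn_ile1.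
rewrite exprS -natr1; move: (u ^+ n) (n%:R) IH h => v N IH /andP[v0 v1].
nra.
Qed.

Variable k : nat.
Hypothesis k_gt1 : (1 < k)%N.

Definition hsum x : R := hurwitz_zeta k x + (-1) ^+ k * hurwitz_zeta k (1 - x).

Lemma hsum1B x : hsum (1 - x) = (-1) ^+ k * hsum x.
Proof.
rewrite /hsum subKr addrC mulrDr; congr (_ + _).
by rewrite mulrA -expr2 sqrr_sign mul1r.
Qed.

Lemma hsum_double x : 0 < x < 1 ->
  hsum (x / 2) + hsum ((x + 1) / 2) = 2 ^+ k * hsum x.
Proof.
move=> /andP[x0 x1].
have := hurwitz_zeta_distr k_gt1 (isT : (0 < 2)%N) x0.
have x1' : 0 < 1 - x by lra.
have := hurwitz_zeta_distr k_gt1 (isT : (0 < 2)%N) x1'.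
rewrite !big_ord_recl !big_ord0 /= !addr0 /hsum /bump /= addn0.
rewrite [x + 1%:R](_ : _ = x + 1) //.
have -> : (1 - x + 1%:R) / 2 = 1 - x / 2 by field.
have -> : 1 - (x + 1) / 2 = (1 - x) / 2 by field.
move: (hurwitz_zeta _ _) (hurwitz_zeta _ (1 - x / 2)) (hurwitz_zeta k (1 - x)) => a b c.
move: (hurwitz_zeta _ (x / 2)) (hurwitz_zeta _ ((x + 1) / 2)) (hurwitz_zeta k x) => d e f.
move=> h1 h2; rewrite mulrDr -h2 mulrCA -h1; ring.
Qed.

Local Notation Q := (cotR R k.-1).

Definition hdiff x := hsum x - pi ^+ k * Q.[cotpi x].

Lemma hdiff1B x : `|hdiff (1 - x)| = `|hdiff x|.
Proof.
rewrite /hdiff hsum1B cotpi1B cotRN prednK 1?ltnW // mulrCA -mulrBr.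
by rewrite normrM normrX normrN1 expr1n mul1r.
Qed.

Lemma hdiff_double x : 0 < x < 1 ->
  2 ^+ k * hdiff x = hdiff (x / 2) + hdiff ((x + 1) / 2).
Proof.
move=> x01; rewrite /hdiff mulrBr -hsum_double // cotpi_half_shift.
have c0 : cotpi (x / 2) != 0.
  rewrite /cotpi mulf_neq0 ?invr_eq0 ?gt_eqF ?cospi_half_gt0 //.
  by apply: sinpi_gt0; lra.
have := cotR_double k.-1 c0; rewrite prednK 1?ltnW // -cotpi_double // => h.
by rewrite mulrCA -h; ring.
Qed.

(* Both sides have the singularity x^-k at 0; only its leading term matters,
   thanks to the weight sin^(k-1). *)
Lemma hdiff_bounded : exists A, forall x, 0 < x < 1 ->
  `|hdiff x| * sin (pi * x) ^+ k.-1 <= A.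
Proof.
have [B hB] := cotR_lower_bound R k.-1.
have kE : k.-1.+1 = k by rewrite prednK // ltnW.
rewrite kE in hB.
exists (hurwitz_zeta k 2^-1 *+ 2 + pi ^+ k * k%:R + pi ^+ k * B) => x x01.
(* Up to sign the difference is symmetric under x -> 1 - x, so only the pole at 0 has to be
   examined; once x^-k is removed, the zeta values left have arguments at least 1/2. *)
wlog xh : x x01 / x <= 1 / 2.
  move=> W; have [/W|xh] := leP x (1 / 2); first exact.
  by rewrite -hdiff1B -sinpi1B; apply: W; lra.
case/andP: (x01) => x0 _; have p0 := @pi_gt0 R.
pose t := pi * x; have t0 : 0 < t by rewrite mulr_gt0.
have s0 : 0 < sin t := sinpi_gt0 x01.
have s1 := sin_le1 t; have c1 := cos_le1 t.
have st := sin_le_id (ltW t0).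
have c0 : 0 <= cos t by apply: cos_ge0_pihalf; rewrite /t; apply/andP; split; nra.
have tcs : t * cos t <= sin t by apply: mul_cos_le_sin; rewrite /t; apply/andP; split; nra.
have := cos2Dsin2 t; rewrite /hdiff /cotpi -/t.
have {}hB := hB (cos t) (sin t); move: hB.
have xE : x = t / pi by rewrite /t mulrC mulKf // gt_eqF.
move: (sin t) (cos t) s0 s1 c1 st c0 tcs => s c s0 s1 c1 st c0 tcs hB cs1.
have {}hB : `|Q.[c / s] - (c / s) ^+ k| * s ^+ k.-1 <= B.
  by apply: hB; rewrite ?s0 ?s1 // ger0_norm.
have sm0 : 0 <= s ^+ k.-1 by rewrite exprn_ge0 // ltW.
have sm1 : s ^+ k.-1 <= 1 by rewrite exprn_ile1 // ltW.
have pk0 : 0 < pi ^+ k :> R by rewrite exprn_gt0.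
have tc0 : 0 <= t * c / s by rewrite divr_ge0 ?mulr_ge0 // ltW.
have st0 : 0 <= s / t by rewrite divr_ge0 // ltW.
have tk0 : 0 <= t ^- k by rewrite invr_ge0 exprn_ge0 // ltW.
have b1 : `|hsum x - x ^- k| <= hurwitz_zeta k 2^-1 *+ 2.
  rewrite /hsum hurwitz_zetaS // addrAC [x ^- k + _]addrC addrK.
  apply: le_trans (ler_normD _ _) _.
  rewrite normrM normrX normrN1 expr1n mul1r mulr2n.
  have h1 : 0 < x + 1 by lra.
  have h2 : 0 < 1 - x by lra.
  have hh : 0 < 2^-1 :> R by lra.
  rewrite !ger0_norm ?hurwitz_zeta_ge0 //.
  by apply: lerD; apply: (hurwitz_zeta_anti k_gt1) => //; lra.
have b2 : `|x ^- k - pi ^+ k * (c / s) ^+ k| * s ^+ k.-1 <= pi ^+ k * k%:R.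
  have -> : x ^- k = pi ^+ k * t ^- k.
    by rewrite xE expr_div_n invf_div.
  rewrite -mulrBr normrM -mulrA gtr0_norm //.
  rewrite ler_pM2l //.
  (* u = t cot t lies in [0, 1] because t cos t <= sin t. Bernoulli bounds 1 - u^k by k (1 - u), and
     1 - u <= t absorbs the remaining factor 1/t. *)
  pose u := t * c / s.
  have u01 : 0 <= u <= 1 by rewrite tc0 /= ler_pdivrMr // mul1r.
  have -> : (c / s) ^+ k = t ^- k * u ^+ k.
    by rewrite -exprVn -exprMn; congr (_ ^+ _); rewrite /u; field; rewrite !gt_eqF.
  have := bernoulli_ile k u01; case/andP: u01 => u0 u1 ub.
  rewrite -{1}[t ^- k]mulr1 -mulrBr ger0_norm; last first.
    by rewrite mulr_ge0 // subr_ge0 exprn_ile1.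
  have -> : t ^- k * (1 - u ^+ k) * s ^+ k.-1 = (s / t) ^+ k.-1 * ((1 - u ^+ k) / t).
    have -> : t ^- k = t^-1 * t ^- k.-1 by rewrite -{1}kE exprS invfM.
    rewrite [(s / t) ^+ _]expr_div_n.
    move: (1 - u ^+ k) (s ^+ k.-1) (t ^- k.-1) (t^-1) => a b d e; ring.
  apply: (@le_trans _ _ ((1 - u ^+ k) / t)).
    rewrite ler_piMl //; first by rewrite divr_ge0 ?subr_ge0 ?exprn_ile1 // ltW.
    by rewrite exprn_ile1 // ler_pdivrMr // mul1r.
  rewrite ler_pdivrMr //; apply: le_trans ub _.
  rewrite ler_wpM2l // /u.
  rewrite -(ler_pM2r s0) mulrBl mul1r divfK ?gt_eqF //.
  have : 1 - c <= s by nra.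
  nra.
have -> : hsum x - pi ^+ k * Q.[c / s] = (hsum x - x ^- k) +
    (x ^- k - pi ^+ k * (c / s) ^+ k) - pi ^+ k * (Q.[c / s] - (c / s) ^+ k) by ring.
apply: (@le_trans _ _ ((`|hsum x - x ^- k| + `|x ^- k - pi ^+ k * (c / s) ^+ k| +
   `|pi ^+ k * (Q.[c / s] - (c / s) ^+ k)|) * s ^+ k.-1)).
  rewrite ler_wpM2r //; apply: le_trans (ler_normB _ _) _.
  by rewrite lerD2r ler_normD.
rewrite 2!mulrDl; apply: lerD; first apply: lerD => //.
  by apply: le_trans b1; rewrite ler_piMr.
by rewrite normrM gtr0_norm // -mulrA ler_wpM2l // ltW.
Qed.

(* Herglotz's trick: duplication shrinks the weighted difference by (c+s)/2 <= 3/4. *)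
Lemma hdiff_contract A : (forall x, 0 < x < 1 -> `|hdiff x| * sin (pi * x) ^+ k.-1 <= A) ->
  forall x, 0 < x < 1 -> `|hdiff x| * sin (pi * x) ^+ k.-1 <= A * (3%:R / 4%:R).
Proof.
move=> hA x x01.
(* The weight has exponent at least 1, as k > 1, so the powers of sine and cosine are bounded by
   their first powers. *)
have [m mE] : exists m, k.-1 = m.+1 by exists k.-2; lia.
have kE : k = m.+2 by lia.
have h1 := hA (x / 2) ltac:(lra).
have h2 := hA ((x + 1) / 2) ltac:(lra).
have h3 := hdiff_double x01.
have c0 := cospi_half_gt0 x01.
have s0 : 0 < sin (pi * (x / 2)) by apply: sinpi_gt0; lra.
move: h2; have -> : pi * ((x + 1) / 2) = pi * (x / 2) + pi / 2 by field.
rewrite sinDpihalf; have -> : pi * x = (pi * (x / 2)) *+ 2 by rewrite -mulr_natr; field.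
rewrite sin_mulr2n -[(_ * _) *+ 2]mulr_natr mE.
have := cos2Dsin2 (pi * (x / 2)); rewrite mE in h1.
move: (cos _) (sin _) c0 s0 h1 => c s c0 s0 h1 cs h2.
have c1 : c <= 1 by nra.
have s1 : s <= 1 by nra.
have hx : `|hdiff x| * 2 ^+ k <= `|hdiff (x / 2)| + `|hdiff ((x + 1) / 2)|.
  rewrite -[2 ^+ k]ger0_norm ?exprn_ge0 // -normrM mulrC h3; exact: ler_normD.
have A0 : 0 <= A by apply: le_trans h1; rewrite mulr_ge0 // exprn_ge0 // ltW.
move: h1 h2 hx; move: `|hdiff x| `|hdiff (x / 2)| `|hdiff ((x + 1) / 2)| => a b d h1 h2 hx.
have cm : c ^+ m.+1 <= c by rewrite exprS ler_piMr // ?exprn_ile1 // ltW.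
have sm : s ^+ m.+1 <= s by rewrite exprS ler_piMr // ?exprn_ile1 // ltW.
have cm0 : 0 <= c ^+ m.+1 by rewrite exprn_ge0 // ltW.
have sm0 : 0 <= s ^+ m.+1 by rewrite exprn_ge0 // ltW.
have -> : a * (c * s * 2) ^+ m.+1 = (a * 2 ^+ k) / 2 * (c ^+ m.+1 * s ^+ m.+1).
  by rewrite !exprMn kE [2 ^+ m.+2]exprS; field.
apply: (@le_trans _ _ ((b + d) / 2 * (c ^+ m.+1 * s ^+ m.+1))).
  apply: ler_wpM2r; first exact: mulr_ge0.
  by apply: ler_wpM2r; first by rewrite invr_ge0.
apply: (@le_trans _ _ ((A * c ^+ m.+1 + A * s ^+ m.+1) / 2)).
  move: (c ^+ m.+1) (s ^+ m.+1) cm0 sm0 h1 h2 => {cm sm}cm sm cm0 sm0 h1 h2; nra.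
(* (c + s)^2 <= 2 (c^2 + s^2) = 2 < 9/4. *)
have cs32 : c + s <= 3%:R / 2 by nra.
nra.
Qed.

Theorem hsum_cot x : 0 < x < 1 -> hsum x = pi ^+ k * Q.[cotpi x].
Proof.
move=> x01; apply/eqP; rewrite -subr_eq0 -/(hdiff x).
have [A hA] := hdiff_bounded.
have hn n : forall y, 0 < y < 1 ->
    `|hdiff y| * sin (pi * y) ^+ k.-1 <= A * (3%:R / 4%:R) ^+ n.
  elim: n => [|n IH] y y01; first by rewrite expr0 mulr1; exact: hA.
  by have := hdiff_contract IH y01; rewrite -mulrA -exprSr.
have g0 : geometric A (3%:R / 4%:R) n @[n --> \oo] --> (0 : R).
  by apply: cvg_geometric; rewrite ger0_norm; lra.
have : `|hdiff x| * sin (pi * x) ^+ k.-1 <= 0.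
  rewrite -(cvg_lim _ g0) //; apply: limr_ge; first by apply/cvg_ex; exists 0.
  by apply: nearW => n; exact: hn.
rewrite pmulr_lle0 ?exprn_gt0 ?sinpi_gt0 //.
by rewrite normr_le0.
Qed.

End Herglotz.

(** * Conjugates of roots of unity *)

(** X^n - 1 is the product of the Phi_d with d | n, so z is a root of one of them; then z^d = 1, and
    primitivity forces d = n. *)
Lemma root_Cyclotomic_prim (F : fieldType) n (z : F) : n.-primitive_root z ->
  root (map_poly intr 'Phi_n) z.
Proof.
move=> zn; have n0 := prim_order_gt0 zn.
have : root (map_poly intr ('X^n - 1 : {poly int})) z.
  rewrite rmorphB rmorph1 /= map_polyXn rootE !hornerE.
  by rewrite (prim_expr_order zn) subrr.
rewrite -prod_Cyclotomic // rmorph_prod rootE horner_prod prodf_seq_eq0 /=.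
move=> /hasP[d]; rewrite -dvdn_divisors // => dn zd.
have [<-//|ne] := eqVneq d n.
have d0 : (0 < d)%N by apply: dvdn_gt0 dn.
have : root (map_poly intr ('X^d - 1 : {poly int})) z.
  rewrite -prod_Cyclotomic // rmorph_prod rootE horner_prod prodf_seq_eq0 /=.
  by apply/hasP; exists d; rewrite // -dvdn_divisors.
rewrite rmorphB rmorph1 /= map_polyXn rootE !hornerE subr_eq0.
move=> /eqP /eqP; rewrite -(prim_order_dvd zn) => nd.
by case/eqP: ne; apply/eqP; rewrite eqn_dvd dn.
Qed.

(** This carries the irreducibility of Phi_n from [algC] to F. The gcd of p and Phi_n is rational
    and has the root z, so it is not constant; a root of it in [algC] is a primitive n-th root with
    minimal polynomial Phi_n, hence Phi_n divides p. *)
Lemma ratr_root_prim (F : numFieldType) n (z w : F) (p : {poly rat}) :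
  n.-primitive_root z -> n.-primitive_root w ->
  root (map_poly ratr p) z -> root (map_poly ratr p) w.
Proof.
move=> zn wn pz; have n0 := prim_order_gt0 zn.
have ZQ (K : numFieldType) : map_poly intr 'Phi_n =
    map_poly ratr (map_poly intr 'Phi_n : {poly rat}) :> {poly K}.
  by rewrite -map_poly_comp; apply: eq_map_poly => a /=; rewrite ratr_int.
set f := map_poly intr 'Phi_n : {poly rat}.
pose g := gcdp p f.
have gz : root (map_poly ratr g) z.
  by rewrite gcdp_map root_gcd pz -ZQ root_Cyclotomic_prim.
have f0 : f != 0.
  rewrite -size_poly_eq0 size_map_inj_poly ?rmorph0 // ?size_Cyclotomic //.
  exact: intr_inj.
have g0 : g != 0 by rewrite gcdp_eq0 negb_and f0 orbT.
have : exists y : algC, root (map_poly ratr g) y.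
  apply/closed_rootP; rewrite size_map_poly; apply: contraL gz.
  move=> /size_poly1P[c c0 ->]; rewrite map_polyC rootC /=.
  by rewrite fmorph_eq0.
move=> [y]; rewrite gcdp_map root_gcd => /andP[py fy].
have yn : n.-primitive_root y.
  have [z0 z0n] := C_prim_root_exists n0.
  move: fy; rewrite -ZQ (Cintr_Cyclotomic z0n).
  by rewrite root_cyclotomic.
have fp : f %| p.
  have [/= m [Dm mmon] mP] := minCpolyP y.
  have -> : f = m; last by rewrite -mP.
  apply: (map_inj_poly (fmorph_inj (@ratr algC)) (rmorph0 _)).
  by rewrite -ZQ (Cintr_Cyclotomic yn) -Dm (minCpoly_cyclotomic yn).
have := root_Cyclotomic_prim wn; rewrite ZQ -/f.
by apply: root_dvdp; rewrite dvdp_map.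
Qed.

(** * Linear disjointness from the real cyclotomic field *)

(** Dickson polynomials of the first kind with parameter 1: D_n(2 cos t) = 2 cos(n t). *)
Fixpoint dickson (n : nat) : {poly rat} :=
  match n with
  | 0%N => 2%:P
  | 1%N => 'X
  | (m.+1 as m').+1 => 'X * dickson m' - dickson m
  end.

Lemma dickson_add (F : numFieldType) n (x y : F) : x * y = 1 ->
  (map_poly ratr (dickson n)).[x + y] = x ^+ n + y ^+ n.
Proof.
move=> xy; suff [] : (map_poly ratr (dickson n)).[x + y] = x ^+ n + y ^+ n /\
  (map_poly ratr (dickson n.+1)).[x + y] = x ^+ n.+1 + y ^+ n.+1 by [].
elim: n => [|n [IH0 IH1]].
  by rewrite /= map_polyC map_polyX hornerC hornerX /= ratr_nat !expr0 !expr1; split; ring.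
split=> //; rewrite [dickson n.+2]/= -/(dickson n.+1).
rewrite rmorphB rmorphM /= map_polyX hornerD hornerN hornerM hornerX IH0 IH1.
rewrite !exprS; transitivity (x * (x * x ^+ n) + y * (y * y ^+ n) + (x * y - 1) * (x ^+ n + y ^+ n)).
  by ring.
by rewrite xy subrr mul0r addr0.
Qed.

Section Cyclo.
Variables (R : realType) (N : nat).
Hypothesis N_gt0 : (0 < N)%N.
Local Notation C := R[i].

Definition ang (m : nat) : R := pi * 2 * (m%:R / N%:R).
Definition th (m : nat) : R := 2 * cos (ang m).
Definition zN : C := Complex (cos (ang 1)) (sin (ang 1)).

Lemma th_cos m : th m = 2 * cos (ang m). Proof. by []. Qed.

Lemma NR0 : N%:R != 0 :> R. Proof. by rewrite pnatr_eq0 -lt0n. Qed.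

Lemma angD m n : ang (m + n) = ang m + ang n.
Proof. by rewrite /ang natrD; field; exact: NR0. Qed.

Lemma zNX m : zN ^+ m = Complex (cos (ang m)) (sin (ang m)).
Proof.
elim: m => [|m IH]; first by rewrite expr0 /ang !mul0r mulr0 cos0 sin0.
rewrite exprSr IH -addn1 angD /zN cosD sinD; apply/eqP.
by rewrite eq_complex /= eqxx /= [sin (ang m) * _ + _]addrC.
Qed.

Lemma ang_half m : ang m = (pi * (m%:R / N%:R)) *+ 2.
Proof. by rewrite /ang mulr2n; ring. Qed.

Lemma zN_prim : N.-primitive_root zN.
Proof.
apply/andP; split=> //; apply/forallP => /= i; rewrite unity_rootE.
have [iN|ne] := eqVneq i.+1 N.
  rewrite iN zNX /ang divff ?NR0 // mulr1 mulr_natr cos2pi sin2pi.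
  by rewrite eqxx.
rewrite eqbF_neg; apply/negP; rewrite zNX => /eqP[c1 _].
have iN : (i.+1 < N)%N by rewrite ltn_neqAle ne ltn_ord.
(* sin(pi m/N) > 0 for 0 < m < N excludes cos(2 pi m/N) = 1. *)
have := @sinpi_gt0 R (i.+1%:R / N%:R).
have NR : 0 < N%:R :> R by rewrite ltr0n.
rewrite divr_gt0 ?ltr0n //= ltr_pdivrMr // mul1r ltr_nat iN => /(_ isT) s0.
move: c1; rewrite ang_half cos_mulr2n.
by have := cos2Dsin2 (pi * (i.+1%:R / N%:R) : R); rewrite mulr2n; nra.
Qed.

Lemma zNN1 : zN * zN ^+ N.-1 = 1.
Proof. by rewrite -exprS prednK // (prim_expr_order zN_prim). Qed.

(** The inverse of z^m is written with the exponent m (N-1), so that it remains a polynomial in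
    z. *)
Lemma zN_inv m : zN ^+ m * zN ^+ (m * N.-1) = 1.
Proof. by rewrite mulnC exprM -exprMn zNN1 expr1n. Qed.

Lemma zN_conj m : zN ^+ (m * N.-1) = Complex (cos (ang m)) (- sin (ang m)).
Proof.
have z0 : zN ^+ m != 0.
  by apply/eqP => e; have := zN_inv m; rewrite e mul0r => /eqP; rewrite eq_sym oner_eq0.
apply: (mulfI z0); rewrite zN_inv zNX; apply/eqP; rewrite eq_complex /=.
by rewrite mulrN opprK -!expr2 cos2Dsin2 mulrN [sin _ * _]mulrC addNr !eqxx.
Qed.

Lemma thE m : (th m)%:C%C = zN ^+ m + zN ^+ (m * N.-1).
Proof.
rewrite zN_conj zNX; apply/eqP; rewrite eq_complex /= subrr eqxx andbT /th.
by rewrite mulr_natl mulr2n.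
Qed.

Lemma dickson_th A b : (map_poly ratr (dickson A)).[th b] = th (b * A).
Proof.
apply: (@complexI R); rewrite -horner_map /= -map_poly_comp /=.
rewrite (eq_map_poly (fmorph_rat _)) !thE dickson_add ?zN_inv //.
by rewrite -!exprM; congr (_ ^+ _ + _ ^+ _); lia.
Qed.

Section OverK.
Variable K : {pred C}.
Hypothesis K_field : number_field K.
Hypothesis K_cyclo : meets_cyclo_plus_in_Q K N.

Let K0 : 0 \in K. Proof. by case: K_field => -[]. Qed.
Let K1 : 1 \in K. Proof. by case: K_field => -[]. Qed.
Let KD x y : x \in K -> y \in K -> x + y \in K.
Proof. by case: K_field => -[_ _ h _ _] _; apply: h. Qed.
Let KN x : x \in K -> - x \in K.
Proof. by case: K_field => -[_ _ _ h _] _; apply: h. Qed.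
Let KM x y : x \in K -> y \in K -> x * y \in K.
Proof. by case: K_field => -[_ _ _ _ h] _; apply: h. Qed.
Let KV x : x \in K -> x^-1 \in K.
Proof. by case: K_field => _ [h _]; apply: h. Qed.

Lemma number_field_ratr (r : rat) : ratr r \in K.
Proof.
have Kn (n : nat) : n%:R \in K.
  by elim: n => [|n IH]; rewrite ?mulr0n // -natr1; apply: KD.
have Kz (m : int) : m%:~R \in K.
  by case: m => n; rewrite ?NegzE ?rmorphN /= -pmulrn //; apply: KN.
by rewrite /ratr; apply: KM => //; apply: KV.
Qed.

Definition coefK (P : {poly C}) := forall i, P`_i \in K.

(** [K] is a bare predicate, so the minimal polynomial is built by hand: an annihilating polynomial
    over K of least degree, made monic. Divisibility is long division, one leading term at a time,
    which keeps the coefficients in K. *)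
Lemma minpolyK (x : C) (P0 : {poly C}) : coefK P0 -> P0 != 0 -> root P0 x ->
  exists G : {poly C}, [/\ coefK G, G \is monic, root G x &
    forall P, coefK P -> root P x -> G %| P].
Proof.
move=> P0K P00 P0x.
pose S n := `[< exists P, [/\ coefK P, P != 0, root P x & size P = n] >].
have exS : exists n, S n by exists (size P0); apply/asboolP; exists P0.
have [n /asboolP[G1 [G1K G10 G1x sG1]] nmin] := ex_minnP exS.
have lc0 : lead_coef G1 != 0 by rewrite lead_coef_eq0.
exists ((lead_coef G1)^-1 *: G1).
set G := _ *: _.
have sG : size G = n by rewrite size_scale ?invr_eq0.
have GK : coefK G by move=> i; rewrite coefZ; apply: KM => //; apply: KV; rewrite lead_coefE.
have Gmon : G \is monic by apply/monicP; rewrite lead_coefZ mulVf.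
have Gx : root G x by rewrite rootZ ?invr_eq0.
split=> // P; have [m] := ubnP (size P); elim: m P => // m IH P sP PK Px.
have [->|P_neq0] := eqVneq P 0; first exact: dvdp0.
have nP : (n <= size P)%N by apply: nmin; apply/asboolP; exists P.
have G_neq0 := monic_neq0 Gmon.
have n0 : (0 < n)%N by rewrite -sG size_poly_gt0.
pose d := (size P - n)%N.
have dn : (d + n = size P)%N by rewrite /d subnK.
pose P' := P - lead_coef P *: ('X^d * G).
have dP' : G %| P'.
  apply: IH.
  - apply: leq_trans (sP : (size P <= m)%N); rewrite -size_poly_gt0 in P_neq0.
    rewrite -(prednK P_neq0) ltnS; apply/leq_sizeP => j hj.
    rewrite coefB coefZ coefXnM.
    have dj : (d <= j)%N.
      by apply: leq_trans hj; rewrite -dn -(prednK n0) addnS /= leq_addr.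
    rewrite ltnNge dj /=.
    have [->|nj] := eqVneq j (size P).-1.
      have -> : ((size P).-1 - d)%N = (size G).-1 by rewrite sG -dn -(prednK n0) addnS /= addKn.
      by rewrite -!lead_coefE (monicP Gmon) mulr1 subrr.
    have jP : (size P <= j)%N by rewrite -(prednK P_neq0) ltn_neqAle eq_sym nj.
    by rewrite !nth_default ?mulr0 ?subr0 // sG -(leq_add2l d) dn subnKC.
  - move=> i; rewrite coefB coefZ coefXnM; apply: KD => //; apply: KN.
    by apply: KM; [rewrite lead_coefE | case: ifP].
  - by rewrite rootE hornerD hornerN hornerZ hornerM (rootP Px) (rootP Gx) !mulr0 subrr.
rewrite -(subrK (lead_coef P *: ('X^d * G)) P); apply: dvdp_add => //.
by rewrite dvdpZr ?lead_coef_eq0 // dvdp_mull.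
Qed.

Let F0 (x : C) := (exists p : {poly rat}, x = (map_poly ratr p).[zN]) /\ x \is Num.real.

Let F0_plus x : F0 x -> cyclo_plus N x.
Proof. by case=> -[p ->] h; split=> //; exists zN; split; [exact: zN_prim | exists p]. Qed.

Let F0_sub x y : F0 x -> F0 y -> F0 (x - y).
Proof.
move=> [[p ->] h] [[r ->] h']; split; last by rewrite rpredB.
by exists (p - r); rewrite rmorphB hornerD hornerN.
Qed.

Let F0_mul x y : F0 x -> F0 y -> F0 (x * y).
Proof.
move=> [[p ->] h] [[r ->] h']; split; last by rewrite rpredM.
by exists (p * r); rewrite rmorphM hornerM.
Qed.

Let F0_01 : F0 0 /\ F0 1.
Proof.
by split; (split; last by rewrite ?rpred0 ?rpred1);
  [exists 0; rewrite rmorph0 horner0 | exists 1; rewrite rmorph1 hornerC].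
Qed.

Let F0_th m : F0 (th m)%:C%C.
Proof.
split; last by rewrite complex_real.
by exists ('X^m + 'X^(m * N.-1)); rewrite thE rmorphD /= !map_polyXn !hornerE.
Qed.

(** All roots of D_N - 2 are real elements of Q(z), so the same holds for the coefficients of the
    minimal polynomial G of [th 1] over K, which divides it; being in K as well, they are rational.
    Then G(X + X^(N-1)) is a rational polynomial that vanishes at z, hence at z^b. *)
Lemma conj_root_K (P : {poly C}) b : coprime b N -> coefK P ->
  root P (th 1)%:C%C -> root P (th b)%:C%C.
Proof.
move=> bN PK Px.
pose Psi : {poly C} := map_poly ratr (dickson N - 2%:P).
have PsiE x y : x * y = 1 -> Psi.[x + y] = x ^+ N + y ^+ N - 2.
  by move=> xy; rewrite /Psi rmorphB /= hornerD hornerN dickson_add // map_polyC hornerC /= ratr_nat.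
(* At 2 + 1/2 the value is (2^N - 1)^2 / 2^N, which is not 0. *)
have Psi0 : Psi != 0.
  apply/eqP => e; have h2 : 2 * 2^-1 = 1 :> C by rewrite divff // pnatr_eq0.
  have := PsiE _ _ h2; rewrite e horner0 exprVn => /esym h.
  have : (2 ^+ N - 1 : C) ^+ 2 = 2 ^+ N * (2 ^+ N + (2 ^+ N)^-1 - 2).
    by field; rewrite expf_neq0 // pnatr_eq0.
  rewrite h mulr0 => /eqP; rewrite expf_eq0 /= subr_eq0 -natrX -[1]/(1%:R) eqr_nat.
  by move=> /eqP; have := ltn_expl N (isT : 1 < 2)%N; lia.
have PsiK : coefK Psi by move=> i; rewrite coef_map; apply: number_field_ratr.
have Psix : root Psi (th 1)%:C%C.
  rewrite rootE thE PsiE ?zN_inv // ![zN ^+ _ ^+ N]exprAC.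
  by rewrite (prim_expr_order zN_prim) !expr1n subrr.
have [G [GK Gmon Gx Gmin]] := minpolyK PsiK Psi0 Psix.
have GF : forall i, F0 G`_i.
  have [r Psir] := closed_field_poly_normal Psi.
  have rF : forall x, x \in r -> F0 x.
    move=> x xr; have : root Psi x.
      by rewrite Psir rootZ ?lead_coef_eq0 // root_prod_XsubC.
    (* Any complex x is y + 1/y, where y solves y^2 = x y - 1. Then D_N(x) = 2 reads (y^N - 1)^2 =
       0, so y is a power of z. *)
    have [y xy] : exists y, x = y + y^-1 /\ y != 0.
      have [w] := @solve_monicpoly C 2 (fun i => if i == 0%N then -1 else x) isT.
      rewrite !big_ord_recl big_ord0 /= expr0 expr1 addr0 => hw.
      have w0 : w != 0.
        apply: contra_eqN hw => /eqP ->; rewrite expr0n /= mulr0 addr0 mulr1.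
        by rewrite eq_sym oppr_eq0 oner_eq0.
      exists w; split=> //; apply: (mulIf w0); rewrite mulrDl mulVf // -expr2 hw; ring.
    case: xy => -> y0; rewrite rootE PsiE ?divff // exprVn => /eqP h.
    have : (y ^+ N - 1) ^+ 2 = y ^+ N * (y ^+ N + (y ^+ N)^-1 - 2).
      by field; rewrite expf_neq0.
    rewrite h mulr0 => /eqP; rewrite expf_eq0 /= subr_eq0 => /eqP yN.
    have [j yj] := prim_rootP zN_prim yN; rewrite yj in y0 *.
    have -> : (zN ^+ j)^-1 = zN ^+ (j * N.-1).
      by apply: (mulfI y0); rewrite divff // zN_inv.
    by rewrite -thE.
  have : G %| \prod_(z <- r) ('X - z%:P).
    by have := Gmin _ PsiK Psix; rewrite {1}Psir dvdpZr // lead_coef_eq0.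
  case/dvdp_prod_XsubC => m; rewrite eqp_monic ?monic_prod_XsubC // => /eqP ->.
  have : forall x, x \in mask m r -> F0 x by move=> x /mem_mask; apply: rF.
  elim: (mask m r) => [_|x s IH hs] i.
    by rewrite big_nil coef1; case: (i == 0%N); case: F0_01.
  have {}IH := IH (fun y hy => hs y (mem_behead (s := x :: s) hy)).
  rewrite big_cons mulrBl coefB coefXM coefCM; apply: F0_sub.
    by case: eqP => // _; case: F0_01.
  by apply: F0_mul => //; apply: hs; rewrite mem_head.
have [g gP] := choice (fun i => K_cyclo (GK i) (F0_plus (GF i))).
pose G0 : {poly rat} := \poly_(i < size G) g i.
have GE : G = map_poly ratr G0.
  apply/polyP => i; rewrite coef_map coef_poly.
  by case: ltnP => h; [rewrite gP | rewrite raddf0 nth_default].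
apply: root_dvdp (Gmin _ PK Px) _.
have h m : G.[(th m)%:C%C] = (map_poly ratr (G0 \Po ('X + 'X^(N.-1)))).[zN ^+ m].
  rewrite map_comp_poly horner_comp rmorphD /= map_polyX map_polyXn !hornerE.
  by rewrite -exprM -thE GE.
rewrite rootE h -rootE.
apply: (ratr_root_prim zN_prim); first by rewrite prim_root_exp_coprime // zN_prim.
by rewrite rootE -[zN]expr1 -h -rootE.
Qed.

End OverK.
End Cyclo.

(** This exhibits the inverse of 1 - w as a rational polynomial in w, the same one for all n-th
    roots of unity w other than 1. *)
Lemma sum_id_mul_expr (F : fieldType) n (w : F) : w ^+ n = 1 -> w != 1 ->
  (1 - w) * \sum_(i < n) i%:R * w ^+ i = - n%:R.
Proof.
move=> wn w1.
have h m : (1 - w) * \sum_(i < m) i%:R * w ^+ i =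
    \sum_(i < m) w ^+ i - m%:R * w ^+ m + (w ^+ m - 1).
  elim: m => [|m IH]; first by rewrite !big_ord0 expr0; ring.
  by rewrite !big_ord_recr /= mulrDr IH -natr1 exprS; ring.
have s0 : \sum_(i < n) w ^+ i = 0.
  have /esym /eqP := subrX1 w n; rewrite wn subrr mulf_eq0 subr_eq0 (negPf w1) /=.
  by move/eqP.
by rewrite h wn s0; ring.
Qed.

(** * Conjugates of the cotangent values *)

Section Conj.
Variables (R : realType) (N : nat).
Hypothesis N_gt0 : (0 < N)%N.
Local Notation C := R[i].
Local Notation th := (th R N).
Local Notation zN := (zN R N).
Local Notation ang := (ang R N).

(* [h] lies in the real cyclotomic field Q(2 cos (2 pi / N)) and [h'] is its image
   under the automorphism induced by z |-> z^b. *)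
Definition conjp b (h h' : R) := exists p : {poly rat},
  h = (map_poly ratr p).[th 1] /\ h' = (map_poly ratr p).[th b].

Lemma conjp_rat b r : conjp b (ratr r) (ratr r).
Proof. by exists r%:P; rewrite map_polyC !hornerC. Qed.

Lemma conjpD b x x' y y' : conjp b x x' -> conjp b y y' -> conjp b (x + y) (x' + y').
Proof. by move=> [p [-> ->]] [r [-> ->]]; exists (p + r); rewrite rmorphD !hornerD. Qed.

Lemma conjpM b x x' y y' : conjp b x x' -> conjp b y y' -> conjp b (x * y) (x' * y').
Proof. by move=> [p [-> ->]] [r [-> ->]]; exists (p * r); rewrite rmorphM !hornerM. Qed.

Lemma conjpB b x x' y y' : conjp b x x' -> conjp b y y' -> conjp b (x - y) (x' - y').
Proof. by move=> [p [-> ->]] [r [-> ->]]; exists (p - r); rewrite rmorphB !hornerD !hornerN. Qed.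

Lemma conjp_sum b (I : Type) (s : seq I) (F F' : I -> R) :
  (forall i, conjp b (F i) (F' i)) -> conjp b (\sum_(i <- s) F i) (\sum_(i <- s) F' i).
Proof.
move=> h; elim: s => [|i s IH]; last by rewrite !big_cons; apply: conjpD.
by rewrite !big_nil; exists 0; rewrite rmorph0 !horner0.
Qed.

Lemma conjp_horner b (p : {poly rat}) x x' : conjp b x x' ->
  conjp b (map_poly ratr p).[x] (map_poly ratr p).[x'].
Proof.
by move=> [r [-> ->]]; exists (p \Po r); rewrite map_comp_poly !horner_comp.
Qed.

Lemma conjp_th b A : conjp b (th A) (th (b * A)).
Proof. by exists (dickson A); rewrite !dickson_th // mul1n. Qed.

Lemma zN_neq1 A : ~~ (N %| A)%N -> zN ^+ A != 1.
Proof. by rewrite (prim_order_dvd (zN_prim R N_gt0)). Qed.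

Lemma zN_predpred A : zN ^+ (A * N.-1 * N.-1) = zN ^+ A.
Proof.
have e := zN_inv R N_gt0 A.
have z0 : zN ^+ (A * N.-1) != 0.
  by apply: contra_eq_neq e => ->; rewrite mulr0 eq_sym oner_eq0.
by apply: (mulfI z0); rewrite zN_inv // mulrC.
Qed.

(** With w = z^A one has 2 - th A = (1 - w)(1 - 1/w), and [sum_id_mul_expr] inverts both factors.
    Swapping i and j conjugates a term of the product of the two sums; adding both copies gives
    cosines and the factor 2. *)
Lemma two_sub_th_mul A : ~~ (N %| A)%N ->
  (2 - th A) * \sum_(i < N) \sum_(j < N) i%:R * j%:R * th ((i + j * N.-1) * A)
    = 2 * N%:R ^+ 2.
Proof.
move=> NA; apply: (@complexI R).
have zz := zN_inv R N_gt0 A.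
pose w := zN ^+ A; pose v := zN ^+ (A * N.-1); rewrite -/w -/v in zz.
have w1 : w != 1 by exact: zN_neq1.
have v1 : v != 1.
  by apply: contra_neq w1 => v1; move: zz; rewrite v1 mulr1.
have zNN : zN ^+ N = 1 := prim_expr_order (zN_prim R N_gt0).
have wN : w ^+ N = 1 by rewrite /w exprAC zNN expr1n.
have vN : v ^+ N = 1 by rewrite /v exprAC zNN expr1n.
have hw := sum_id_mul_expr wN w1; have hv := sum_id_mul_expr vN v1.
rewrite [LHS]rmorphM rmorphB rmorph_sum [RHS]rmorphM /= thE // !rmorph_nat -/w -/v.
have -> : \sum_(i < N) (\sum_(j < N) i%:R * j%:R * th ((i + j * N.-1) * A))%:C%C
   = 2 * ((\sum_(i < N) i%:R * w ^+ i) * (\sum_(j < N) j%:R * v ^+ j)).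
  transitivity (\sum_(i < N) \sum_(j < N)
     (i%:R * w ^+ i * (j%:R * v ^+ j) + i%:R * v ^+ i * (j%:R * w ^+ j))).
    apply: eq_bigr => i _; rewrite rmorph_sum; apply: eq_bigr => j _ /=.
    rewrite [LHS]rmorphM [X in X * _]rmorphM /= thE // !rmorph_nat.
    have -> : zN ^+ ((i + j * N.-1) * A) = w ^+ i * v ^+ j.
      by rewrite /w /v -!exprM -exprD; congr (_ ^+ _); ring.
    have -> : zN ^+ ((i + j * N.-1) * A * N.-1) = v ^+ i * w ^+ j.
      rewrite /v -[w]zN_predpred -!exprM -exprD; congr (_ ^+ _); ring.
    ring.
  rewrite big_distrlr /= [RHS]mulr_natl mulr2n.
  under eq_bigr do rewrite big_split /=.
  rewrite big_split /=; congr (_ + _); rewrite exchange_big /=.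
  by apply: eq_bigr => i _; apply: eq_bigr => j _; rewrite mulrC.
have -> : 2 - (w + v) = (1 - w) * (1 - v).
  by transitivity (1 - w - v + w * v); [rewrite zz; ring | ring].
rewrite rmorphXn /= rmorph_nat.
transitivity (2 * (((1 - w) * \sum_(i < N) i%:R * w ^+ i) * ((1 - v) * \sum_(j < N) j%:R * v ^+ j))).
  by ring.
by rewrite hw hv; ring.
Qed.

Lemma two_sub_th_neq0 A : ~~ (N %| A)%N -> 2 - th A != 0.
Proof.
move=> /two_sub_th_mul; apply: contra_eq_neq => ->; rewrite mul0r eq_sym.
by rewrite mulf_neq0 ?expf_neq0 ?pnatr_eq0 // -lt0n.
Qed.

(** [conjp] asks for a polynomial witness, so inversion needs a formula for 1 / (2 - th B) that is
    uniform in B; the double cosine sum supplies it. *)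
Lemma conjp_inv b A : coprime b N -> ~~ (N %| A)%N ->
  conjp b (2 - th A)^-1 (2 - th (b * A))^-1.
Proof.
move=> bN NA.
have NbA : ~~ (N %| b * A)%N by rewrite Gauss_dvdr // coprime_sym.
have e B : ~~ (N %| B)%N -> (2 - th B)^-1 = ratr (2 * N%:R ^+ 2)^-1 *
    \sum_(i < N) \sum_(j < N) ratr (i%:R * j%:R) * th ((i + j * N.-1) * B).
  move=> NB; have h := two_sub_th_mul NB.
  apply: (mulfI (two_sub_th_neq0 NB)); rewrite divff ?two_sub_th_neq0 //.
  rewrite mulrCA; under eq_bigr do under eq_bigr do rewrite rmorphM /= !ratr_nat.
  rewrite h fmorphV rmorphM rmorphXn /= !ratr_nat mulVf //.
  by rewrite mulf_neq0 ?expf_neq0 ?pnatr_eq0 // -lt0n.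
rewrite !e //; apply: conjpM; first exact: conjp_rat.
apply: conjp_sum => i; apply: conjp_sum => j; apply: conjpM; first exact: conjp_rat.
have -> : ((i + j * N.-1) * (b * A) = b * ((i + j * N.-1) * A))%N by ring.
exact: conjp_th.
Qed.

Lemma sin_sqr_th A : 2 - th A = 4%:R * sin (pi * (A%:R / N%:R)) ^+ 2.
Proof.
rewrite th_cos ang_half // cos_mulr2n mulr2n.
by have := cos2Dsin2 (pi * (A%:R / N%:R) : R); lra.
Qed.

Lemma cos_sqr_th A : 2 + th A = 4%:R * cos (pi * (A%:R / N%:R)) ^+ 2.
Proof. by rewrite th_cos ang_half // cos_mulr2n mulr2n; ring. Qed.

Lemma cotpi_sqr A : ~~ (N %| A)%N ->
  cotpi (A%:R / N%:R) ^+ 2 = (2 + th A) * (2 - th A)^-1.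
Proof.
move=> NA; rewrite /cotpi; have := two_sub_th_neq0 NA.
rewrite sin_sqr_th cos_sqr_th; move: (sin _) (cos _) => s c h.
have s0 : s != 0 by apply: contraNneq h => ->; rewrite expr0n mulr0.
by field.
Qed.

(** With u = pi b A/N, the difference of the two cosine values is 4 sin(2u) sin(2 pi b/N), while 2 -
    th(b A) = 4 sin(u)^2. *)
Lemma sin_cotpi b A : (0 < A)%N -> ~~ (N %| b * A)%N ->
  2 * sin (ang b) * cotpi ((b * A)%:R / N%:R) =
  (th (b * A.-1) - th (b * A.+1)) * (2 - th (b * A))^-1.
Proof.
move=> A0 NA; have := two_sub_th_neq0 NA; rewrite sin_sqr_th => h.
have e : ang (b * A) = ang (b * A.-1) + ang b.
  by rewrite -angD //; congr ang; case: A A0 {NA h} => // A _ /=; rewrite mulnS addnC.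
have -> : th (b * A.-1) = 2 * cos (ang (b * A) - ang b) by rewrite e addrK.
have -> : th (b * A.+1) = 2 * cos (ang (b * A) + ang b).
  by rewrite -angD // th_cos; congr (_ * cos (ang _)); rewrite mulnS addnC.
rewrite cosB cosD [ang (b * A)]ang_half // sin_mulr2n /cotpi [(_ * _) *+ 2]mulr2n.
move: h; move: (sin (pi * _)) (cos (pi * _)) => s c h.
have s0 : s != 0 by apply: contraNneq h => ->; rewrite expr0n mulr0.
by field.
Qed.

(* For odd k the values lie in sqrt(-1) Q(zeta_N), and this factor brings them
   into the real cyclotomic field. *)
Definition twist (k b : nat) : R := if odd k then 2 * sin (ang b) else 1.

(** A vanishing sine would make z^(2b) equal to 1, and N would divide 2. *)
Lemma twist_neq0 k b : (odd k -> (2 < N)%N) -> coprime b N -> twist k b != 0.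
Proof.
rewrite /twist; case: (odd k) => [/(_ isT) N2 bN|_ _]; last exact: oner_neq0.
rewrite mulf_neq0 ?pnatr_eq0 //; apply/eqP => s0.
have : zN ^+ (b * 2) = 1.
  rewrite zNX // muln2 -addnn angD //.
  have := cos2Dsin2 (ang b); rewrite cosD sinD s0 expr0n /= !addr0 !(mulr0, mul0r).
  by rewrite subr0 addr0 -expr2 => ->.
move/eqP; rewrite -(prim_order_dvd (zN_prim R N_gt0)) Gauss_dvdr 1?coprime_sym //.
by move/dvdn_leq => /(_ isT); rewrite leqNgt N2.
Qed.

(** By parity the polynomial is a polynomial in X^2, times X when k is odd. The squared cotangent
    conjugates through [cotpi_sqr]; the single cotangent left over is absorbed by the twist. *)
Lemma conjp_cot k b A : (0 < k)%N -> coprime b N -> ~~ (N %| A)%N ->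
  conjp b (twist k 1 * (cotR R k.-1).[cotpi (A%:R / N%:R)])
          (twist k b * (cotR R k.-1).[cotpi ((b * A)%:R / N%:R)]).
Proof.
move=> k0 bN NA; rewrite /cotR; have [r ->] := cotp_parity k.-1.
have NbA : ~~ (N %| b * A)%N by rewrite Gauss_dvdr // coprime_sym.
have A0 : (0 < A)%N by case: A NA {NbA} => //; rewrite dvdn0.
rewrite prednK // rmorphM /= map_polyXn map_comp_poly map_polyXn !hornerM !horner_comp.
rewrite !hornerXn !mulrA !cotpi_sqr //; apply: conjpM; last first.
  apply: conjp_horner; apply: conjpM; last exact: conjp_inv.
  apply: conjpD; last exact: conjp_th.
  by rewrite -(ratr_nat R 2); exact: conjp_rat.
rewrite /twist; case: (odd k); rewrite ?expr0 ?expr1 ?mulr1.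
  have := @sin_cotpi 1 A A0; rewrite !mul1n => -> //.
  rewrite sin_cotpi //; apply: conjpM; last exact: conjp_inv.
  by apply: conjpB; exact: conjp_th.
by rewrite -[1](ratr_nat R 1); exact: conjp_rat.
Qed.

(** Scaled by e, the relation says that a polynomial over K vanishes at [th 1]; its vanishing at
    [th b] conjugates the real factors and leaves the [c i] untouched. *)
Lemma conj_relation (K : {pred C}) b (I : Type) (s : seq I) (c : I -> C)
    (e e' : R) (h h' : I -> R) :
  number_field K -> meets_cyclo_plus_in_Q K N -> coprime b N -> e' != 0 ->
  (forall i, c i \in K) -> (forall i, conjp b (e * h i) (e' * h' i)) ->
  \sum_(i <- s) c i * (h i)%:C%C = 0 -> \sum_(i <- s) c i * (h' i)%:C%C = 0.
Proof.
move=> KF Kcyc bN e0 cK hc hs.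
have [p pP] := choice hc.
pose P : {poly C} := \sum_(i <- s) c i *: map_poly ratr (p i).
have PE m : P.[(th m)%:C%C] = \sum_(i <- s) c i * ((map_poly ratr (p i)).[th m])%:C%C.
  rewrite /P horner_sum; apply: eq_bigr => i _; rewrite hornerZ; congr (_ * _).
  rewrite -horner_map /= -map_poly_comp /=.
  by rewrite (eq_map_poly (fmorph_rat _)).
have PK : coefK K P.
  move=> i; rewrite /P coef_sum.
  case: (KF) => -[K0 _ KD _ KM] _.
  elim: (s) => [|j t IH]; first by rewrite big_nil.
  rewrite big_cons KD // coefZ KM // coef_map; exact: number_field_ratr.
have /(conj_root_K N_gt0 KF Kcyc bN PK) : root P (th 1)%:C%C.
  rewrite rootE PE; apply/eqP.
  transitivity (e%:C%C * \sum_(i <- s) c i * (h i)%:C%C); last by rewrite hs mulr0.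
  rewrite mulr_sumr; apply: eq_bigr => i _.
  by case: (pP i) => <- _; rewrite rmorphM /= mulrCA.
rewrite rootE PE => /eqP hb.
have eC : e'%:C%C != 0 :> C by rewrite fmorph_eq0.
apply: (mulfI eC); rewrite mulr0 mulr_sumr -[RHS]hb; apply: eq_bigr => i _.
by case: (pP i) => _ <-; rewrite rmorphM /= mulrCA.
Qed.

End Conj.

(** * Inverting the zeta operator on residue classes *)

Lemma coprime_mod_inv b q : (1 < q)%N -> coprime b q ->
  exists2 b', coprime b' q & ((b' * b) %% q = 1)%N.
Proof.
(* x is a multiple of b congruent to 1 modulo q, and its cofactor is the inverse. *)
move=> q1 bq; pose x := chinese b q 0 1.
have bx : (b %| x)%N by rewrite /dvdn chinese_modl // mod0n.
have xq : (x %% q = 1)%N by rewrite chinese_modr // modn_small.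
case/dvdnP: bx => b' xE; exists b'; last by rewrite -xE.
have : coprime x q by rewrite -coprime_modl xq coprime1n.
by rewrite xE coprimeMl => /andP[].
Qed.

Section Dominance.
Variables (R : realType) (k q : nat).
Hypothesis k_gt1 : (1 < k)%N.
Hypothesis q_gt1 : (1 < q)%N.
Local Notation C := R[i].

Let q0 : (0 < q)%N. Proof. exact: ltnW. Qed.

Definition mulord b (a : 'I_q) : 'I_q := Ordinal (ltn_pmod (b * a) q0).

Lemma coprime_mulord b (a : 'I_q) : coprime b q ->
  coprime (mulord b a) q = coprime a q.
Proof. by move=> bq; rewrite /= coprime_modl coprimeMl bq. Qed.

Lemma mulord_inv b b' (a : 'I_q) : ((b' * b) %% q = 1)%N ->
  mulord b' (mulord b a) = a.
Proof.
move=> bb; apply: val_inj; rewrite /= modnMmr mulnA -modnMml bb mul1n.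
by rewrite modn_small.
Qed.

Lemma sum_mulord (V : zmodType) b (F : 'I_q -> V) : coprime b q ->
  \sum_(a : 'I_q | coprime a q) F (mulord b a) = \sum_(a : 'I_q | coprime a q) F a.
Proof.
move=> bq; have [b' b'q bb] := coprime_mod_inv q_gt1 bq.
rewrite [RHS](reindex_onto (mulord b) (mulord b')); last first.
  by move=> a _; apply: mulord_inv; rewrite mulnC.
apply: eq_bigl => a; rewrite coprime_mulord //.
by rewrite mulord_inv // eqxx andbT.
Qed.

Lemma coprime_ord_gt0 (a : 'I_q) : coprime a q -> (0 < a)%N.
Proof. by case: (posnP a) => // ->; rewrite /coprime gcd0n => /eqP e; move: q_gt1; rewrite e. Qed.

Local Notation Z a := (hurwitz_zeta k (a%:R / q%:R) : R).

Lemma ord_frac_gt0 a : (0 < a)%N -> 0 < a%:R / q%:R :> R.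
Proof. by move=> a0; rewrite divr_gt0 ?ltr0n. Qed.

(* zeta(k) < 2 makes the class of 1 outweigh all the others together. *)
Lemma zeta_coprime_sum_lt :
  \sum_(a : 'I_q | coprime a q) Z a < 2 * Z 1%N.
Proof.
apply: (@lt_le_trans _ _ (2 * q%:R ^+ k)); last first.
  rewrite ler_pM2l //; apply: le_trans (hurwitz_zeta_geV k_gt1 (ord_frac_gt0 _)) => //.
  by rewrite -exprVn invf_div divr1.
apply: (@le_lt_trans _ _ (q%:R ^+ k * hurwitz_zeta k 1)); last first.
  by rewrite mulrC ltr_pM2r ?exprn_gt0 ?ltr0n // zeta_lt2.
rewrite -hurwitz_zeta_distr //.
have c0 : coprime 0 q = false by rewrite /coprime gcd0n gtn_eqF.
have -> : \sum_(a : 'I_q | coprime a q) Z a = \sum_(0 <= a < q | coprime a q) Z a.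
  by rewrite big_mkord.
rewrite big_ltn_cond // c0 big_add1.
rewrite -(big_mkord xpredT (fun i => hurwitz_zeta k ((1 + i%:R) / q%:R) : R)).
rewrite [leRHS](big_cat_nat (leq0n _) (leq_pred q)) /=; apply: ler_wpDr.
  by apply: sumr_ge0 => i _; rewrite hurwitz_zeta_ge0 // divr_gt0 ?ltr0n // ltr_wpDr.
rewrite big_mkcond /=; apply: ler_sum => i _.
rewrite -natr1 [1 + _]addrC; case: ifP => // _.
by rewrite hurwitz_zeta_ge0 // divr_gt0 ?ltr0n // ltr_wpDl.
Qed.

Lemma zeta_operator_inj_real (d : 'I_q -> R) :
  (forall b, coprime b q ->
     \sum_(a : 'I_q | coprime a q) d a * Z (mulord b a) = 0) ->
  forall a : 'I_q, coprime a q -> d a = 0.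
Proof.
move=> hd a1 a1q.
pose a0 := [arg max_(a > a1 | coprime (val a) q) `|d a| ]%O.
have [a0q a0max] : coprime a0 q /\ forall a : 'I_q, coprime a q -> `|d a| <= `|d a0|.
  by rewrite /a0; case: arg_maxP.
suff d0 : d a0 = 0 by have := a0max _ a1q; rewrite d0 normr0 normr_le0 => /eqP.
(* With b inverse to a0 the largest coefficient meets the dominant value Z 1, and the other terms
   together are too small to cancel it. *)
have [b bq bb] := coprime_mod_inv q_gt1 a0q.
have Zp (a : 'I_q) : coprime a q -> 0 < Z (mulord b a).
  move=> aq; apply: (hurwitz_zeta_gt0 k_gt1); apply: ord_frac_gt0.
  by apply: coprime_ord_gt0; rewrite coprime_mulord.
have := hd b bq; rewrite (bigD1 a0) //= bb => /eqP; rewrite addr_eq0 => /eqP h.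
have := sum_mulord (fun a : 'I_q => Z a) bq; rewrite (bigD1 a0) //= bb => hZ.
have := zeta_coprime_sum_lt; rewrite -hZ.
set T := \sum_(_ | _) _ => hT.
have : `|d a0| * Z 1%N <= `|d a0| * T.
  rewrite -[Z 1%N]gtr0_norm; last by apply: (hurwitz_zeta_gt0 k_gt1); apply: ord_frac_gt0.
  rewrite -normrM h normrN; apply: le_trans (ler_norm_sum _ _ _) _.
  rewrite mulr_sumr; apply: ler_sum => a /andP[aq _].
  by rewrite normrM [`|hurwitz_zeta _ _|]gtr0_norm ?Zp // ler_pM2r ?Zp // a0max.
have [//|n0] := eqVneq (d a0) 0.
by rewrite ler_pM2l ?normr_gt0 //; lra.
Qed.

Lemma zeta_operator_inj (d : 'I_q -> C) :
  (forall b, coprime b q ->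
     \sum_(a : 'I_q | coprime a q) d a * (Z (mulord b a))%:C%C = 0) ->
  forall a : 'I_q, coprime a q -> d a = 0.
Proof.
move=> hd a aq.
have ReS (F : 'I_q -> C) : complex.Re (\sum_(a : 'I_q | coprime a q) F a) =
    \sum_(a : 'I_q | coprime a q) complex.Re (F a).
  by elim/big_rec2: _ => // i x y _ <-; case: (F i) y => ? ? [].
have ImS (F : 'I_q -> C) : complex.Im (\sum_(a : 'I_q | coprime a q) F a) =
    \sum_(a : 'I_q | coprime a q) complex.Im (F a).
  by elim/big_rec2: _ => // i x y _ <-; case: (F i) y => ? ? [].
apply/eqP; rewrite eq_complex; apply/andP; split; apply/eqP.
  apply: (@zeta_operator_inj_real (fun a => complex.Re (d a))) => // b bq.
  have := congr1 (@complex.Re R) (hd b bq); rewrite ReS => h; apply: etrans h.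
  by apply: eq_bigr => i _; case: (d i) => x y /=; rewrite mulr0 subr0.
apply: (@zeta_operator_inj_real (fun a => complex.Im (d a))) => // b bq.
have := congr1 (@complex.Im R) (hd b bq); rewrite ImS => h; apply: etrans h.
by apply: eq_bigr => i _; case: (d i) => x y /=; rewrite mulr0 add0r.
Qed.

End Dominance.

(** * Residues modulo sign *)

Section HalfSystem.
Variable q : nat.
Hypothesis q_gt2 : (2 < q)%N.
Let q_gt1 : (1 < q)%N. Proof. exact: ltnW. Qed.
Let q0 : (0 < q)%N. Proof. exact: ltnW. Qed.

Definition half_reps (n : nat) := [seq a <- iota 1 n | (a.*2 < n)%N && coprime a n].

Lemma big_half_reps (V : zmodType) (F : nat -> V) :
  \sum_(a <- half_reps q) F a = \sum_(a : 'I_q | coprime a q && (a.*2 < q)%N) F a.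
Proof.
rewrite big_filter -[RHS](big_mkord (fun a => coprime a q && (a.*2 < q)%N)).
rewrite (_ : iota 1 q = index_iota 1 q.+1); last by rewrite /index_iota subn1.
have c0 : coprime 0 q = false by rewrite /coprime gcd0n gtn_eqF.
(* The list runs over 1..q and the ordinals over 0..q-1; 0 is not coprime to q, and q fails the test
   [a.*2 < q]. *)
rewrite [RHS]big_ltn_cond // c0 /= [LHS]big_mkcond big_nat_recr //= -big_mkcond /=.
have -> : (q.*2 < q)%N = false by lia.
by rewrite addr0; apply: eq_bigl => a; rewrite andbC.
Qed.

Lemma half_reps_bounds a : a \in half_reps q -> [/\ (0 < a)%N, (a.*2 < q)%N & coprime a q].
Proof.
by rewrite mem_filter mem_iota => /andP[/andP[-> ->]] /andP[-> _].
Qed.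

Lemma modn_compl m : ~~ (q %| m)%N -> ((m * q.-1) %% q = q - m %% q)%N.
Proof.
move=> qm; have m0 : (0 < m %% q)%N by rewrite lt0n.
have mq : (m %% q < q)%N by rewrite ltn_pmod.
rewrite -modnMml.
have -> : (m %% q * q.-1 = (m %% q).-1 * q + (q - m %% q))%N by nia.
by rewrite modnMDl modn_small //; lia.
Qed.

Local Notation neg := (mulord q_gt1 q.-1).

Lemma negE (a : 'I_q) : coprime a q -> ((q.-1 * a) %% q = q - a)%N.
Proof.
move=> aq; rewrite mulnC modn_compl; first by rewrite modn_small.
by rewrite gtnNdvd // coprime_ord_gt0.
Qed.

Lemma sum_upper_half (V : zmodType) (F : 'I_q -> V) :
  \sum_(a : 'I_q | coprime a q && ~~ (a.*2 < q)%N) F a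
  = \sum_(a : 'I_q | coprime a q && (a.*2 < q)%N) F (neg a).
Proof.
have q1q : coprime q.-1 q by rewrite coprimePn.
have negK (a : 'I_q) : neg (neg a) = a.
  have /andP[p0 pq] : (0 < q.-1 < q)%N by move: q_gt2; lia.
  apply: mulord_inv; rewrite modn_compl; last by rewrite gtnNdvd.
  by rewrite modn_small //; move: q_gt2; lia.
rewrite (reindex_onto neg neg) //=; apply: eq_bigl => a.
rewrite negK eqxx andbT coprime_mulord //.
case aq: (coprime a q) => //=; rewrite negE //.
(* A unit a with 2a = q divides q, hence equals 1, against q > 2; so negation exchanges the two
   halves exactly. *)
have : (a.*2 != q)%N.
  apply/eqP => e; have /gcdn_idPl ga : (a %| q)%N by apply/dvdnP; exists 2%N; rewrite mul2n.
  by move: aq e; rewrite /coprime ga => /eqP ->; move: q_gt2; lia.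
by have := ltn_ord a; lia.
Qed.

Lemma size_half_reps : ((size (half_reps q)).*2 = totient q)%N.
Proof.
pose L := [pred a : 'I_q | coprime a q && (a.*2 < q)%N].
pose U := [pred a : 'I_q | coprime a q && ~~ (a.*2 < q)%N].
have h1 : size (half_reps q) = #|L|.
  apply/eqP; rewrite -(eqr_nat int) -sumr_const -(big_half_reps (fun=> 1)).
  by rewrite big_const_seq count_predT iter_addr_0.
have h2 : #|U| = #|L| by apply/eqP; rewrite -(eqr_nat int) -!sumr_const sum_upper_half.
rewrite totient_count_coprime big_mkord -addnn {1}h1 h1 -{2}h2 -!sum1_card.
under [RHS]eq_bigr do rewrite coprime_sym.
rewrite -[RHS]big_mkcond /=.
by rewrite [RHS](bigID (fun a : 'I_q => (a.*2 < q)%N)).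
Qed.

Variables (R : realType) (k : nat).
Local Notation C := R[i].
Local Notation Z a := (hurwitz_zeta k (a%:R / q%:R) : R).

(** Extension to all units with the parity of k: the summand (-1)^k zeta(k, 1-x) of [hsum] becomes
    the contribution of the class -a. *)
Definition extend (c : nat -> C) (a : nat) : C :=
  if (a.*2 < q)%N then c a else (-1) ^+ k * c (q - a)%N.

Lemma half_reps_fold (c : nat -> C) b : coprime b q ->
  \sum_(a <- half_reps q) c a * (hsum k (((b * a) %% q)%:R / q%:R : R))%:C%C =
  \sum_(a : 'I_q | coprime a q) extend c a * (Z (mulord q_gt1 b a))%:C%C.
Proof.
move=> bq; rewrite big_half_reps [RHS](bigID (fun a : 'I_q => (a.*2 < q)%N)) /=.
rewrite sum_upper_half -big_split /=; apply: eq_bigr => a /andP[aq ah].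
have e : ((b * ((q.-1 * a) %% q)) %% q = q - (b * a) %% q)%N.
  rewrite modnMmr mulnCA [(q.-1 * _)%N]mulnC modn_compl //.
  by rewrite Gauss_dvdr 1?coprime_sym // gtnNdvd // coprime_ord_gt0.
have nh : ((q - a).*2 < q)%N = false by have := ltn_ord a; lia.
rewrite /= e /extend ah negE // nh subKn ?(ltnW (ltn_ord a)) // /hsum.
have -> : 1 - ((b * a) %% q)%:R / q%:R = (q - (b * a) %% q)%:R / q%:R :> R.
  rewrite natrB; last by rewrite ltnW // ltn_pmod.
  by rewrite mulrBl divff // pnatr_eq0 -lt0n.
rewrite rmorphD rmorphM rmorphXn rmorphN1 /=; ring.
Qed.

Hypothesis k_gt1 : (1 < k)%N.

Lemma half_system_const (c : nat -> C) (c0 : C) :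
  (forall b, coprime b q ->
    \sum_(a <- half_reps q) c a * (hsum k (((b * a) %% q)%:R / q%:R : R))%:C%C = c0) ->
  if odd k then forall a, a \in half_reps q -> c a = 0
  else exists g, forall a, a \in half_reps q -> c a = g.
Proof.
move=> hc.
have ext a (aq : (a < q)%N) : a \in half_reps q -> extend c (Ordinal aq) = c a.
  by case/half_reps_bounds => _ ah _; rewrite /extend /= ah.
have alt a : a \in half_reps q -> (a < q)%N by case/half_reps_bounds; lia.
case: ifP => kodd.
  (* Replacing b = 1 by b = -1 turns every argument x into 1 - x, which changes the sign of the sum
     for odd k. *)
  have c00 : c0 = 0.
    have h1 := hc 1%N (coprime1n q).
    have h2 := hc q.-1%N (coprimePn q0).
    suff : c0 = - c0 by move/eqP; rewrite -addr_eq0 -mulr2n mulrn_eq0 => /eqP.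
    rewrite -[LHS]h2 -[in RHS]h1 -mulN1r mulr_sumr big_seq [RHS]big_seq; apply: eq_bigr => a au.
    have [a0 ah aq] := half_reps_bounds au.
    rewrite mul1n [(q.-1 * a)%N]mulnC modn_compl; last by rewrite gtnNdvd // alt.
    rewrite natrB; last by rewrite ltnW // ltn_pmod.
    rewrite mulrBl divff; last by rewrite pnatr_eq0 -lt0n.
    by rewrite hsum1B -signr_odd kodd expr1 mulN1r rmorphN mulrN mulN1r.
  move=> a au; rewrite -(ext a (alt a au) au).
  apply: (@zeta_operator_inj R k q k_gt1 q_gt1 (fun i : 'I_q => extend c i) _ (Ordinal (alt a au))).
    by move=> b bq; rewrite -half_reps_fold // hc.
  by case: (half_reps_bounds au).
(* Constant coefficients also give a sum independent of b, a multiple of T > 0. Subtracting g = c0/T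
   leaves an element of the kernel of the operator. *)
pose T : R := \sum_(a : 'I_q | coprime a q) Z a.
have T0 : T != 0.
  rewrite gt_eqF // /T (bigD1 (Ordinal q_gt1)) ?coprime1n //= ltr_pwDl //.
    by apply: (hurwitz_zeta_gt0 k_gt1); apply: ord_frac_gt0.
  apply: sumr_ge0 => a /andP[aq _]; apply: (hurwitz_zeta_ge0 k_gt1); apply: ord_frac_gt0 => //.
  exact: coprime_ord_gt0 aq.
pose g := c0 / T%:C%C; exists g => a au; rewrite -(ext a (alt a au) au).
apply/eqP; rewrite -subr_eq0; apply/eqP.
apply: (@zeta_operator_inj R k q k_gt1 q_gt1 (fun i : 'I_q => extend c i - g) _ (Ordinal (alt a au)));
  last by case: (half_reps_bounds au).
move=> b bq; under eq_bigr do rewrite mulrBl.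
rewrite sumrB -half_reps_fold // hc // -mulr_sumr.
have -> : \sum_(a : 'I_q | coprime a q) (Z (mulord q_gt1 b a))%:C%C = T%:C%C.
  by rewrite -rmorph_sum (sum_mulord q_gt1 (fun a : 'I_q => Z a) bq).
by rewrite /g divfK ?subrr // fmorph_eq0.
Qed.

End HalfSystem.

(** * Linear relations between the generators *)

Section Gens.
Variables (R : realType) (k : nat).
Hypothesis k_gt1 : (1 < k)%N.
Local Notation C := R[i].

Definition reps (q : nat) := if (2 < q)%N then half_reps q else [:: 1%N].

Definition gval (q a : nat) : R :=
  if (2 < q)%N then hsum k (a%:R / q%:R)
  else if q == 2%N then hurwitz_zeta k (1 / 2) * (1 + (-1) ^+ k)
  else hurwitz_zeta k 1 * (1 + (-1) ^+ k).

Lemma VgensE q : Vgens R k q = [seq (gval q a)%:C%C | a <- reps q].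
Proof. by rewrite /Vgens /reps /gval; case: ifP => // _; case: ifP. Qed.

Lemma cotpi_modn q n : (0 < q)%N ->
  cotpi (n%:R / q%:R : R) = cotpi ((n %% q)%:R / q%:R).
Proof.
move=> q0; have qR : q%:R != 0 :> R by rewrite pnatr_eq0 -lt0n.
rewrite {1}(divn_eq n q); elim: (n %/ q)%N => [|m IH]; first by rewrite mul0n add0n.
rewrite -IH mulSn -addnA natrD mulrDl divff // addrC cotpiD1.
by [].
Qed.

Lemma zeta_half : hurwitz_zeta k (1 / 2) = (2 ^+ k - 1) * hurwitz_zeta k 1 :> R.
Proof.
have := hurwitz_zeta_distr k_gt1 (isT : (0 < 2)%N) (ltr01 : 0 < 1 :> R).
rewrite !big_ord_recl big_ord0 /= addr0 /bump /= addn0.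
have -> : (1 + 1%:R) / 2 = 1 :> R by field.
by rewrite addr0 => h; rewrite mulrBl -h [1 * hurwitz_zeta _ _]mul1r addrK.
Qed.

(** The generator for q <= 2 divided by pi^k. At x = 1/2 the cotangent vanishes, which leaves the
    constant term of the polynomial; q = 1 differs by the factor 2^k - 1 of [zeta_half]. For even k
    this amounts to Euler's theorem that zeta(k)/pi^k is rational. *)
Definition small_val (q : nat) : rat :=
  if odd k then 0
  else if q == 2%N then (cotp k.-1).[0] else (cotp k.-1).[0] / (2 ^+ k - 1).

Lemma gval_small q a : (q <= 2)%N -> gval q a = pi ^+ k * ratr (small_val q).
Proof.
rewrite leqNgt => /negPf q2; rewrite /gval q2 /small_val -signr_odd.
case kodd: (odd k); first by rewrite expr1 subrr !mulr0 rmorph0 mulr0 if_same.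
have h : hurwitz_zeta k (1 / 2) * (1 + 1) = pi ^+ k * ratr (cotp k.-1).[0] :> R.
  have -> : hurwitz_zeta k (1 / 2) * (1 + 1) = hsum k (1 / 2) :> R.
    have -> : hsum k (1 / 2) = hurwitz_zeta k (1 / 2) + hurwitz_zeta k (1 / 2) :> R.
      rewrite /hsum -signr_odd kodd expr0 [1 * hurwitz_zeta _ _]mul1r.
      by have -> : 1 - 1 / 2 = 1 / 2 :> R by field.
    by rewrite mulrDr mulr1.
  rewrite hsum_cot //; last lra.
  by rewrite /cotpi mul1r cos_pihalf mul0r /cotR -[0 in LHS](rmorph0 (@ratr R)) horner_map.
rewrite expr0; case: ifP => // _.
have e0 : (2 ^+ k - 1 : R) != 0.
  by rewrite subr_eq0 -natrX -[1](mulr1n) eqr_nat; have := ltn_expl k (isT : 1 < 2)%N; lia.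
apply: (mulfI e0); rewrite mulrA -zeta_half h rmorphM fmorphV rmorphB rmorphXn rmorph1 /=.
by rewrite ratr_nat; field.
Qed.

End Gens.

Lemma dvdn_big_prod l (q : nat -> nat) j : (j < l)%N -> (q j %| \prod_(i < l) q i)%N.
Proof. by move=> jl; rewrite (bigD1 (Ordinal jl)) //= dvdn_mulr. Qed.

(** Conjugation by B will act as b on block j0 and fix the values in all other blocks. *)
Lemma chinese_block l (q : nat -> nat) j0 b :
  (forall i j, (i < l)%N -> (j < l)%N -> i != j -> coprime (q i) (q j)) ->
  (j0 < l)%N -> coprime b (q j0) ->
  exists B, [/\ coprime B (\prod_(j < l) q j), B = b %[mod q j0] &
    forall j, (j < l)%N -> j != j0 -> B = 1 %[mod q j]].
Proof.
move=> q_coprime jl bq; pose M := (\prod_(j < l | j != j0 :> nat) q j)%N.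
have NE : (\prod_(j < l) q j = (q j0 * M))%N by rewrite (bigD1 (Ordinal jl)).
have qM : coprime (q j0) M.
  apply: (big_ind (fun x => coprime (q j0) x)); first exact: coprimen1.
    by move=> x y hx hy; rewrite coprimeMr hx.
  by move=> j ne; rewrite q_coprime // eq_sym.
exists (chinese (q j0) M b 1).
have B1 : chinese (q j0) M b 1 = b %[mod q j0] by rewrite chinese_modl.
have B2 : chinese (q j0) M b 1 = 1 %[mod M] by rewrite chinese_modr.
split=> //.
  rewrite NE coprimeMr -coprime_modl B1 coprime_modl bq /=.
  by rewrite -coprime_modl B2 coprime_modl coprime1n.
move=> j jl' ne; have qjM : (q j %| M)%N by rewrite /M (bigD1 (Ordinal jl')) //= dvdn_mulr.
by rewrite -(modn_dvdm _ qjM) B2 modn_dvdm.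
Qed.


(** * Isolating one block of a relation *)

Section Relation.
Variables (R : realType) (k l N : nat) (q : nat -> nat) (K : {pred R[i]}).
Local Notation C := R[i].
Hypothesis k_gt1 : (1 < k)%N.
Hypothesis q_gt0 : forall j, (j < l)%N -> (1 <= q j)%N.
Hypothesis N0 : (0 < N)%N.
Hypothesis qN : forall j, (j < l)%N -> (q j %| N)%N.
Hypothesis chineseN : forall j0 b, (j0 < l)%N -> coprime b (q j0) ->
  exists B, [/\ coprime B N, B = b %[mod q j0] &
    forall j, (j < l)%N -> j != j0 -> B = 1 %[mod q j]].
Hypothesis K_field : number_field K.
Hypothesis K_cyclo : meets_cyclo_plus_in_Q K N.

Lemma block_relation (c : nat -> nat -> C) : (forall j a, c j a \in K) ->
  \sum_(j < l) \sum_(a <- reps (q j)) c j a * (gval R k (q j) a)%:C%C = 0 ->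
  forall j, (j < l)%N -> (2 < q j)%N ->
  if odd k then forall a, a \in half_reps (q j) -> c j a = 0
  else exists g, forall a, a \in half_reps (q j) -> c j a = g.
Proof.
move=> cK rel j0 jl q2.
pose rest := \sum_(j < l | j != j0 :> nat) \sum_(a <- reps (q j)) c j a * (gval R k (q j) a)%:C%C.
apply: (@half_system_const (q j0) q2 R k k_gt1 (c j0) (- rest)) => b bq.
have [B [BN Bb B1]] := chineseN jl bq.
(* a / q_j is rewritten with the common denominator N, so that one conjugation acts on all
   blocks. *)
pose A (x : nat * nat) := (x.2 * (N %/ q x.1))%N.
(* [conj_relation] wants conjugate values at every index, including pairs outside the summation
   range. Where N divides [A x], and on blocks with q_j <= 2, a rational number that conjugation
   fixes is used. *)
pose ok x := ~~ (N %| A x)%N && (2 < q x.1)%N.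
pose Q := cotR R k.-1.
pose h x : R := if ok x then Q.[cotpi ((A x)%:R / N%:R)] else ratr (small_val k (q x.1)).
pose h' x : R := if ok x then Q.[cotpi ((B * A x)%:R / N%:R)] else ratr (small_val k (q x.1)).
have pk0 : (pi ^+ k : R)%:C%C != 0 :> C by rewrite fmorph_eq0 expf_neq0 // gt_eqF // pi_gt0.
have NR : N%:R != 0 :> R by rewrite pnatr_eq0 -lt0n.
have k0 : (0 < k)%N by exact: ltnW.
have Nq0 j : (j < l)%N -> (0 < N %/ q j)%N.
  by move=> jl'; rewrite divn_gt0; [exact: dvdn_leq N0 (qN jl') | exact: q_gt0].
have frac j a m : (j < l)%N -> (m * A (j, a))%:R / N%:R = (m * a)%:R / (q j)%:R :> R.
  move=> jl'; rewrite /A /= mulnA natrM -{2}(divnK (qN jl')) natrM.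
  have n1 : (N %/ q j)%:R != 0 :> R.
    by rewrite pnatr_eq0 -lt0n Nq0.
  have n2 : (q j)%:R != 0 :> R by rewrite pnatr_eq0 -lt0n q_gt0.
  by field; rewrite n1 n2.
have okE j a : (j < l)%N -> (2 < q j)%N -> a \in half_reps (q j) -> ok (j, a).
  move=> jl' qj2 au; have [a0 ah aq] := half_reps_bounds au.
  rewrite /ok /A /= qj2 andbT -{1}(divnK (qN jl')) mulnC dvdn_pmul2r.
    by rewrite gtnNdvd //; lia.
  exact: Nq0.
have okF j a : (q j <= 2)%N -> ok (j, a) = false.
  by rewrite leqNgt => /negPf qj; rewrite /ok /= qj andbF.
have hcot j m : (j < l)%N -> (0 < m %% q j)%N ->
    pi ^+ k * Q.[cotpi (m%:R / (q j)%:R)] = hsum k ((m %% q j)%:R / (q j)%:R).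
  move=> jl' m0; have qj0 : 0 < (q j)%:R :> R by rewrite ltr0n q_gt0.
  rewrite cotpi_modn; last exact: q_gt0.
  rewrite -hsum_cot //; apply/andP; split; first by rewrite divr_gt0 // ltr0n.
  by rewrite ltr_pdivrMr // mul1r ltr_nat ltn_pmod // q_gt0.
have hE j a : (j < l)%N -> a \in reps (q j) -> gval R k (q j) a = pi ^+ k * h (j, a).
  move=> jl'; rewrite /reps; case: (ltnP 2 (q j)) => qj2 au; last first.
    by rewrite gval_small // /h okF.
  have [a0 ah aq] := half_reps_bounds au.
  rewrite /h okE // -[A _]mul1n frac // mul1n hcot // modn_small; try lia.
  by rewrite /gval qj2.
have h'E j a : (j < l)%N -> a \in reps (q j) ->
    pi ^+ k * h' (j, a) = if j == j0 then hsum k (((b * a) %% q j0)%:R / (q j0)%:R)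
                          else gval R k (q j) a.
  move=> jl'; rewrite /reps; case: (ltnP 2 (q j)) => qj2 au; last first.
    rewrite /h' okF // gval_small //; case: eqP => // jj; move: q2; rewrite -jj; lia.
  have [a0 ah aq] := half_reps_bounds au.
  rewrite /h' okE // frac //; case: eqP => [jj|/eqP ne].
    rewrite jj in qj2 ah aq *.
    have e : ((B * a) %% q j0 = (b * a) %% q j0)%N by rewrite -modnMml Bb modnMml.
    rewrite hcot // e // lt0n -[_ == _]/(q j0 %| _)%N Gauss_dvdr 1?coprime_sym //.
    by rewrite gtnNdvd //; lia.
  have e : ((B * a) %% q j = a)%N.
    by rewrite -modnMml B1 // modnMml mul1n modn_small //; lia.
  by rewrite hcot // e // /gval qj2.
pose s := [seq (j, a) | j <- iota 0 l, a <- reps (q j)].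
have sumE (F : nat * nat -> C) : \sum_(x <- s) F x =
    \sum_(j < l) \sum_(a <- reps (q j)) F (j : nat, a).
  rewrite big_allpairs_dep /= -[l]subn0 -/(index_iota 0 l) big_mkord subn0; by [].
have rel0 : \sum_(x <- s) c x.1 x.2 * (h x)%:C%C = 0.
  apply: (mulfI pk0); rewrite mulr0 -[RHS]rel mulr_sumr.
  rewrite sumE /=.
  apply: eq_bigr => j _; rewrite big_seq [RHS]big_seq; apply: eq_bigr => a ar.
  by rewrite hE // rmorphM /= mulrCA.
have odd2 : odd k -> (2 < N)%N by move=> _; apply: leq_trans (dvdn_leq N0 (qN jl)).
have hc x : conjp N B (twist R N k 1 * h x) (twist R N k B * h' x).
  rewrite /h /h'; case: ifP => [/andP[NA _]|_]; first exact: conjp_cot.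
  rewrite /small_val /twist; case: (odd k); last by rewrite !mul1r; exact: conjp_rat.
  by rewrite rmorph0 !mulr0; exists 0; rewrite rmorph0 !horner0.
have := conj_relation N0 K_field K_cyclo BN (twist_neq0 R N0 odd2 BN) (fun x => cK x.1 x.2) hc rel0.
move/(congr1 (fun x => (pi ^+ k)%:C%C * x)); rewrite mulr0 mulr_sumr.
rewrite sumE /=.
rewrite (bigD1 (Ordinal jl)) //= => /eqP; rewrite addr_eq0 => /eqP e.
transitivity (\sum_(a <- reps (q j0)) (pi ^+ k)%:C%C * (c j0 a * (h' (j0, a))%:C%C)).
  rewrite big_seq [RHS]big_seq /reps q2; apply: eq_bigr => a ar.
  by rewrite mulrCA -rmorphM h'E // ?eqxx // /reps q2.
(* The other blocks are unchanged: B is 1 modulo their q_j, or their values are rational multiples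
   of pi^k. *)
rewrite e; congr (- _); apply: eq_bigr => j /= ne.
rewrite big_seq [RHS]big_seq; apply: eq_bigr => a ar.
have {}ne : (j : nat) != j0 by [].
by rewrite mulrCA -rmorphM h'E // (negPf ne).
Qed.

End Relation.

(** * Dimension of a span from its block relations *)

Section Dim.
Variables (R : realType) (K : {pred R[i]}).
Local Notation C := R[i].
Hypothesis K_field : number_field K.
Implicit Types (c s : seq C) (m : bitseq) (cs ss : seq (seq C)).

Let K0 : 0 \in K. Proof. by case: K_field => -[]. Qed.
Let K1 : 1 \in K. Proof. by case: K_field => -[]. Qed.
Let KN x : x \in K -> - x \in K.
Proof. by case: K_field => -[_ _ _ h _] _; apply: h. Qed.

Definition lc c s : C := \sum_(i < size s) c`_i * s`_i.

Lemma lc_nil c : lc c [::] = 0. Proof. by rewrite /lc big_ord0. Qed.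

Lemma lc_cons x c y s : lc (x :: c) (y :: s) = x * y + lc c s.
Proof. by rewrite /lc /= big_ord_recl. Qed.

Lemma lc_cat c1 c2 s1 s2 : size c1 = size s1 ->
  lc (c1 ++ c2) (s1 ++ s2) = lc c1 s1 + lc c2 s2.
Proof.
elim: s1 c1 => [|y s1 IH] [|x c1] //= => [_|[e]]; first by rewrite lc_nil add0r.
by rewrite !lc_cons IH // addrA.
Qed.

Lemma lc_nseq n x s : size s = n -> lc (nseq n x) s = x * \sum_(y <- s) y.
Proof.
move=> <-; elim: s => [|y s IH]; first by rewrite lc_nil big_nil mulr0.
by rewrite lc_cons IH big_cons mulrDr.
Qed.

Definition zoff m c := all2 (fun b x => b || (x == 0)) m c.

Lemma lc_mask m c s : size m = size s -> size c = size s -> zoff m c ->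
  lc (mask m c) (mask m s) = lc c s.
Proof.
elim: s m c => [|y s IH] [|b m] [|x c] //= [sm] [sc] /andP[bx zc].
rewrite lc_cons; case: b bx => /= [_|/eqP ->]; rewrite ?lc_cons IH //.
by rewrite mul0r add0r.
Qed.

Fixpoint expand m c : seq C :=
  match m with
  | [::] => [::]
  | true :: m' => head 0 c :: expand m' (behead c)
  | false :: m' => 0 :: expand m' c
  end.

Lemma expandP m c : size c = count id m -> all (fun x => x \in K) c ->
  [/\ size (expand m c) = size m, mask m (expand m c) = c,
      all (fun x => x \in K) (expand m c) & zoff m (expand m c)].
Proof.
elim: m c => [|[] m IH] [|x c] //= => [[e] /andP[xK cK]|e cK|e /= cK].
- by have [-> -> -> ->] := IH c e cK; rewrite xK.
- by have [-> -> -> ->] := IH [::] e cK; rewrite K0 eqxx.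
- by have [-> -> -> ->] := IH (x :: c) e cK; rewrite K0 eqxx.
Qed.

(** Sublists are handled through full-length coefficient lists that vanish off the mask, so block
    relations apply without renumbering; [expand] and [mask] translate between the two. *)
Lemma indep_maskP m s : size m = size s ->
  indepK K (mask m s) <->
  (forall c, size c = size s -> all (fun x => x \in K) c -> zoff m c ->
    lc c s = 0 -> all (pred1 0) c).
Proof.
move=> sm; split=> [ind c sc cK zc e|ind c sc cK e].
  have h : forall i, (mask m c)`_i = 0.
    apply: ind; first by rewrite !size_mask ?sc.
      by apply/allP => x /mem_mask /(allP cK).
    by rewrite -[LHS]/(lc _ _) lc_mask.
  have {h} : all (pred1 0) (mask m c).
    by apply/(all_nthP 0) => i _; apply/eqP.
  elim: m c zc {sm sc cK e ind} => [|b m IH] [|x c] //= /andP[bx zc].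
  by case: b bx => /= [_ /andP[-> /(IH _ zc)]|/= -> /(IH _ zc)].
have sc' : size c = count id m by rewrite sc size_mask.
have [h1 h2 h3 h4] := expandP sc' cK.
have : all (pred1 0) (expand m c).
  by apply: ind => //; rewrite ?h1 // -(lc_mask sm) ?h1 // h2.
move=> /allP h i; have [si|si] := ltnP i (size c); last by rewrite nth_default.
by apply/eqP; apply: h; apply: (@mem_mask _ _ m); rewrite h2 mem_nth.
Qed.

Lemma lc_flatten cs ss : shape cs = shape ss ->
  lc (flatten cs) (flatten ss) = \sum_(j < size ss) lc (nth [::] cs j) (nth [::] ss j).
Proof.
elim: ss cs => [|s ss IH] [|c cs] //= => [_|[e1 e2]]; first by rewrite lc_nil big_ord0.
by rewrite lc_cat // IH // big_ord_recl.
Qed.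

Lemma zoff_flatten (ms : seq bitseq) cs : shape ms = shape cs ->
  zoff (flatten ms) (flatten cs) = all2 zoff ms cs.
Proof.
elim: ms cs => [|m ms IH] [|c cs] //= [e1 e2].
rewrite -IH // /zoff; elim: m c e1 => [|b m IHm] [|x c] //= [e].
by rewrite IHm // andbA.
Qed.

Lemma all_flatten (T : Type) (P : pred T) (ts : seq (seq T)) :
  all P (flatten ts) = all (all P) ts.
Proof. by elim: ts => //= t ts IH; rewrite all_cat IH. Qed.

Lemma indep_flattenP (ms : seq bitseq) ss : shape ms = shape ss ->
  indepK K (mask (flatten ms) (flatten ss)) <->
  (forall cs, shape cs = shape ss -> all (all (fun x => x \in K)) cs ->
    all2 zoff ms cs -> \sum_(j < size ss) lc (nth [::] cs j) (nth [::] ss j) = 0 ->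
    all (all (pred1 0)) cs).
Proof.
move=> sh; rewrite indep_maskP ?size_flatten ?sh //.
split=> [ind cs shc cK zc e|ind c sc cK zc e].
  rewrite -all_flatten; apply: ind; rewrite ?lc_flatten ?all_flatten //.
    by rewrite !size_flatten shc.
  by rewrite zoff_flatten // sh.
have cE : flatten (reshape (shape ss) c) = c by rewrite reshapeKr // sc.
have cS : shape (reshape (shape ss) c) = shape ss by rewrite reshapeKl // sc.
rewrite -cE all_flatten; apply: ind => //.
- by rewrite -all_flatten cE.
- by rewrite -zoff_flatten ?sh // cE.
- by rewrite -lc_flatten // cE.
Qed.

Lemma dimK_flatten_eq ss n :
  (exists ms : seq bitseq, [/\ shape ms = shape ss,
     indepK K (mask (flatten ms) (flatten ss)) & sumn (map (count id) ms) = n]) ->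
  (forall ms : seq bitseq, shape ms = shape ss ->
     indepK K (mask (flatten ms) (flatten ss)) -> (sumn (map (count id) ms) <= n)%N) ->
  dimK K (flatten ss) = n.
Proof.
have cnt (ms : seq bitseq) : count id (flatten ms) = sumn (map (count id) ms).
  by rewrite count_flatten.
move=> [ms [sh ind cn]] ub; apply/eqP; rewrite eqn_leq; apply/andP; split.
  apply/bigmax_leqP => m /asboolP indm.
  have sm : size m = size (flatten ss) by rewrite size_tuple.
  have mE : flatten (reshape (shape ss) m) = m.
    by rewrite reshapeKr // sm size_flatten.
  rewrite -mE cnt; apply: ub; last by rewrite mE.
  by rewrite reshapeKl // sm size_flatten.
have sz : size (flatten ms) == size (flatten ss) by rewrite !size_flatten sh.
rewrite -cn -cnt.
apply: (@leq_bigmax_cond _ (fun t : (size (flatten ss)).-tuple bool =>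
  `[< indepK K (mask t (flatten ss)) >]) (fun t => count id t) (Tuple sz)).
exact/asboolP.
Qed.

Lemma shape_mkseq (T : Type) (f : nat -> seq T) n :
  shape (mkseq f n) = mkseq (fun j => size (f j)) n.
Proof. by rewrite /shape /mkseq -map_comp. Qed.

Lemma shapeE (T : Type) (ts : seq (seq T)) :
  shape ts = mkseq (fun j => size (nth [::] ts j)) (size ts).
Proof. by rewrite -shape_mkseq mkseq_nth. Qed.

Lemma shape_nth (T T' : Type) (ts : seq (seq T)) (us : seq (seq T')) j :
  shape ts = shape us -> size (nth [::] ts j) = size (nth [::] us j).
Proof. by move=> e; rewrite -!nth_shape e. Qed.

Lemma all2_zoffP (ms : seq bitseq) cs : size ms = size cs ->
  reflect (forall j, (j < size cs)%N -> zoff (nth [::] ms j) (nth [::] cs j)) (all2 zoff ms cs).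
Proof.
elim: ms cs => [|m ms IH] [|c cs] //= => [_|[e]]; first by constructor.
apply: (iffP andP) => [[h1 /(IH _ e) h2] [|j] //|h]; first exact: h2.
by split; [exact: (h 0%N) | apply/(IH _ e) => j; exact: (h j.+1)].
Qed.

Lemma sumn_mkord (f : nat -> nat) n : sumn (mkseq f n) = (\sum_(j < n) f j)%N.
Proof. by rewrite sumnE big_map -[n in iota 0 n]subn0 -/(index_iota 0 n) big_mkord. Qed.

Lemma zoff_full m c : all id m -> size c = size m -> zoff m c.
Proof. by elim: m c => [|b m IH] [|x c] //= /andP[-> hm] [e]; apply: IH. Qed.

Lemma zoff_nseqF n c : zoff (nseq n false) c -> all (pred1 0) c.
Proof. by elim: n c => [|n IH] [|x c] //= /andP[/= -> /IH]. Qed.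

Lemma zoff0 m n : size m = n -> zoff m (nseq n 0).
Proof. by move=> <-; elim: m => //= b m ->; rewrite eqxx orbT. Qed.

(* When the only relations are between the block sums, and these span a line,
   each block after the first one contributes all but one of its elements. *)
Lemma dimK_flatten_line ss (rho : nat -> C) (z : C) : (0 < size ss)%N -> z != 0 ->
  (forall j, (j < size ss)%N -> (0 < size (nth [::] ss j))%N) ->
  (forall j, (j < size ss)%N -> rho j \in K /\ rho j != 0) ->
  (forall j, (j < size ss)%N -> \sum_(y <- nth [::] ss j) y = rho j * z) ->
  (forall cs, shape cs = shape ss -> all (all (fun x => x \in K)) cs ->
    \sum_(j < size ss) lc (nth [::] cs j) (nth [::] ss j) = 0 ->
    forall j, (j < size ss)%N -> exists g, nth [::] cs j = nseq (size (nth [::] ss j)) g) ->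
  dimK K (flatten ss) = ((\sum_(j < size ss) size (nth [::] ss j)) - (size ss).-1)%N.
Proof.
move=> n0 z0 s0 rhoK sums rel; set n := size ss in n0 *.
pose S j := size (nth [::] ss j).
have SP j : (j < n)%N -> (S j = (S j).-1.+1)%N by move=> jn; rewrite prednK // s0.
apply: dimK_flatten_eq.
  (* Block 0 is kept whole and every other block loses its first element; the coefficients of such a
     block are constant, with a zero in the dropped place, hence all zero. *)
  pose f j := if j == 0%N then nseq (S j) true else false :: nseq (S j).-1 true.
  have szf j : (j < n)%N -> size (f j) = S j.
    by move=> jn; rewrite /f; case: eqP => _ /=; rewrite size_nseq // -SP.
  have sh : shape (mkseq f n) = shape ss.
    rewrite shape_mkseq [RHS]shapeE; apply/eq_in_map => j.
    by rewrite mem_iota /= => jn; exact: szf.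
  exists (mkseq f n); split=> //.
    apply/indep_flattenP => // cs shc cK zc e.
    have szc : size cs = n by rewrite -(size_map size cs) [map _ _]shc size_map.
    have {}zc := elimT (all2_zoffP _) zc; rewrite size_mkseq szc in zc.
    have {}zc j : (j < n)%N -> zoff (f j) (nth [::] cs j).
      by move=> jn; have := zc (erefl _) j jn; rewrite nth_mkseq.
    have tail j : (0 < j < n)%N -> nth [::] cs j = nseq (S j) 0.
      move=> /andP[j0 jn]; have [g gE] := rel cs shc cK e j jn.
      have := zc j jn; rewrite gE /f gtn_eqF // -/(S j) SP //= => /andP[/eqP -> _].
      by [].
    have [g gE] := rel cs shc cK e 0%N n0.
    have g0 : g = 0.
      move: e; rewrite -/n -(prednK n0) big_ord_recl big1 ?addr0; last first.
        move=> i _; rewrite tail ?lc_nseq ?mul0r //.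
        by have := ltn_ord i; rewrite /= /bump /= add1n; move: n0; lia.
      rewrite gE lc_nseq // sums // => /eqP; rewrite !mulf_eq0 (negPf z0) orbF.
      by case: (rhoK 0%N n0) => _ /negPf ->; rewrite orbF => /eqP.
    apply/(all_nthP [::]) => j; rewrite szc => jn.
    have [j0|j0] := posnP j; first by rewrite j0 gE g0 all_nseq /= eqxx orbT.
    by rewrite tail ?j0 // all_nseq /= eqxx orbT.
  rewrite /mkseq -map_comp -/(mkseq _ _) sumn_mkord.
  rewrite -[n in RHS](prednK n0) -[n in LHS](prednK n0) !big_ord_recl /=.
  rewrite /f /= count_nseq mul1n.
  rewrite (eq_bigr (fun i : 'I_n.-1 => S (bump 0 i) - 1)%N); last first.
    by move=> i _; rewrite /= count_nseq mul1n add0n subn1.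
  have le i : (i < n.-1)%N -> (0 < S (bump 0 i))%N.
    by move=> h; apply: s0; rewrite /bump /= add1n -/n; lia.
  rewrite sumnB; last by move=> i _; exact: le.
  rewrite sum1_card card_ord addnBA //.
  rewrite -[X in (X <= _)%N]card_ord -sum1_card; apply: leq_sum => i _; exact: le.
move=> ms sh /(indep_flattenP sh) ind.
have szm : size ms = n by rewrite -(size_map size ms) [map _ _]sh size_map.
have -> : sumn (map (count id) ms) = (\sum_(j < n) count id (nth [::] ms j))%N.
  by rewrite -(sumn_mkord (fun j => count id (nth [::] ms j))) -szm
    -[in LHS](mkseq_nth [::] ms) /mkseq -map_comp.
pose full (j : 'I_n) := all id (nth [::] ms j).
have szj (j : 'I_n) : size (nth [::] ms j) = S j by exact: shape_nth.
(* Two fully selected blocks would carry a nontrivial relation: [rho j'] times the sum of block j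
   minus [rho j] times the sum of block j'. *)
have one (j j' : 'I_n) : full j -> full j' -> j = j'.
  move=> fj fj'; apply/eqP/negPn/negP => ne.
  pose v (i : nat) : C := if i == j then rho j' else if i == j' then - rho j else 0.
  pose cs := mkseq (fun i => nseq (S i) (v i)) n.
  have vK i : v i \in K.
    by rewrite /v; case: ifP => _; [case: (rhoK j') | case: ifP => _ //; apply: KN; case: (rhoK j)].
  have : all (all (pred1 0)) cs.
    apply: ind.
    - rewrite shape_mkseq [RHS]shapeE; apply: eq_map => i; exact: size_nseq.
    - apply/allP => c /mapP[i _ ->]; rewrite all_nseq vK; exact: orbT.
    - apply/all2_zoffP; rewrite size_mkseq // => i iN; rewrite nth_mkseq //.
      have szi : size (nth [::] ms i) = S i by exact: shape_nth.
      rewrite /v; case: eqP => [ij|_].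
        by apply: zoff_full; rewrite ?size_nseq // ij.
      case: eqP => [ij|_]; last exact: zoff0.
      by apply: zoff_full; rewrite ?size_nseq // ij.
    - rewrite -/n (bigD1 j) //= (bigD1 j') /=; last by rewrite eq_sym ne.
      rewrite big1 ?addr0; last first.
        move=> i /andP[/negPf n1 /negPf n2]; rewrite nth_mkseq // lc_nseq // /v.
        by rewrite -[_ == _ :> nat]/(i == j) n1 -[_ == _ :> nat]/(i == j') n2 mul0r.
      rewrite !nth_mkseq // !lc_nseq // !sums // /v eqxx.
      rewrite -[_ == _ :> nat]/(j' == j) eq_sym (negPf ne) eqxx; ring.
  move=> /(all_nthP [::]) /(_ j); rewrite size_mkseq ltn_ord nth_mkseq // => /(_ isT).
  rewrite all_nseq /v eqxx /= gtn_eqF ?s0 //=.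
  by case: (rhoK j') => // _ /negPf ->.
have cle : (\sum_(j < n) (count id (nth [::] ms j) + 1) <= \sum_(j < n) (S j + full j))%N.
  apply: leq_sum => j _; rewrite -szj /full all_count.
  by have := count_size id (nth [::] ms j); case: eqP; lia.
have f1 : (\sum_(j < n) full j <= 1)%N.
  have -> : (\sum_(j < n) full j = #|full|)%N by rewrite -sum1_card [RHS]big_mkcond.
  by apply/card_le1_eqP => j j' hj hj'; exact: one.
move: cle; rewrite !big_split /= sum1_card card_ord -/n.
by move: f1; set a := (\sum_(j < n) full j)%N; set b := (\sum_(j < n) count _ _)%N;
  set d := (\sum_(j < n) S j)%N; lia.
Qed.

Lemma lc_zero c s : all (pred1 0) s -> lc c s = 0.
Proof.
by move=> /(all_nthP 0) h; rewrite /lc big1 // => i _; rewrite (eqP (h i (ltn_ord i))) mulr0.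
Qed.

(** This is the situation of odd k: the generators for q <= 2 are zero, and those of the other
    blocks satisfy no relation. *)
Lemma dimK_flatten_free ss (good : pred nat) :
  (forall j, (j < size ss)%N -> ~~ good j -> all (pred1 0) (nth [::] ss j)) ->
  (forall cs, shape cs = shape ss -> all (all (fun x => x \in K)) cs ->
    \sum_(j < size ss) lc (nth [::] cs j) (nth [::] ss j) = 0 ->
    forall j, (j < size ss)%N -> good j -> all (pred1 0) (nth [::] cs j)) ->
  dimK K (flatten ss) = (\sum_(j < size ss | good j) size (nth [::] ss j))%N.
Proof.
move=> bad rel; set n := size ss.
pose S j := size (nth [::] ss j).
apply: dimK_flatten_eq.
  pose f j := nseq (S j) (good j).
  have sh : shape (mkseq f n) = shape ss.
    by rewrite shape_mkseq [RHS]shapeE; apply: eq_map => j; exact: size_nseq.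
  exists (mkseq f n); split=> //.
    apply/indep_flattenP => // cs shc cK zc e.
    have szc : size cs = n by rewrite -(size_map size cs) [map _ _]shc size_map.
    have {}zc := elimT (all2_zoffP _) zc; rewrite size_mkseq szc in zc.
    apply/(all_nthP [::]) => j; rewrite szc => jn.
    case gj: (good j); first exact: rel.
    by have := zc (erefl _) j jn; rewrite nth_mkseq // /f gj => /zoff_nseqF.
  rewrite /mkseq -map_comp -/(mkseq _ _) sumn_mkord [RHS]big_mkcond.
  by apply: eq_bigr => j _; rewrite /= count_nseq; case: (good j); rewrite ?mul1n ?mul0n.
move=> ms sh /(indep_flattenP sh) ind.
have szm : size ms = n by rewrite -(size_map size ms) [map _ _]sh size_map.
have -> : sumn (map (count id) ms) = (\sum_(j < n) count id (nth [::] ms j))%N.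
  by rewrite -(sumn_mkord (fun j => count id (nth [::] ms j))) -szm
    -[in LHS](mkseq_nth [::] ms) /mkseq -map_comp.
rewrite [leqRHS]big_mkcond; apply: leq_sum => j _.
have szj i : size (nth [::] ms i) = S i by exact: shape_nth.
case gj: (good j); first by rewrite -[size _]/(S j) -szj count_size.
rewrite leqn0; apply/eqP.
(* On a block of zeros the mask itself, read as a 0/1 list, is a relation, so independence forces it
   to be empty there. *)
pose cs := mkseq (fun i =>
  if i == j :> nat then [seq (nat_of_bool b)%:R | b : bool <- nth [::] ms j]
  else nseq (S i) 0 : seq C) n.
have : all (all (pred1 0)) cs.
  apply: ind.
  - rewrite shape_mkseq [RHS]shapeE; apply: eq_map => i /=.
    by case: eqP => [->|_]; rewrite ?size_map ?szj ?size_nseq.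
  - apply/allP => c /mapP[i _ ->]; case: eqP => _; last by rewrite all_nseq K0 orbT.
    by rewrite all_map; apply/allP => -[] _ /=.
  - apply/all2_zoffP; rewrite size_mkseq // => i iN; rewrite nth_mkseq //.
    case: eqP => [->|_]; last exact: zoff0.
    by elim: (nth [::] ms j) => //= b m ->; case: b; rewrite ?eqxx ?orbT.
  - rewrite big1 // => i _; rewrite nth_mkseq //; case: eqP => [->|_].
      by rewrite lc_zero // bad // gj.
    by rewrite lc_nseq // mul0r.
move=> /(all_nthP [::]) /(_ j); rewrite size_mkseq ltn_ord nth_mkseq // eqxx => /(_ isT).
by elim: (nth [::] ms j) => //= b m IH /andP[hb /IH ->]; case: b hb => //=; rewrite oner_eq0.
Qed.

End Dim.

(** * Sums of the generators of one block *)

Section BlockSum.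
Variables (R : realType) (k : nat).
Hypothesis k_gt1 : (1 < k)%N.
Local Notation C := R[i].
Local Notation z1 := (hurwitz_zeta k 1 : R).

Let ratmul (x : R) := exists r : rat, x = ratr r * z1.

Let ratmul_sum (I : Type) (s : seq I) (P : pred I) (F : I -> R) :
  (forall i, P i -> ratmul (F i)) -> ratmul (\sum_(i <- s | P i) F i).
Proof.
move=> h; apply: (big_ind ratmul) => //; first by exists 0; rewrite rmorph0 mul0r.
by move=> _ _ [r ->] [r' ->]; exists (r + r'); rewrite rmorphD mulrDl.
Qed.

(** The index runs over 1..d, not 0..d-1, so that d = 1 gives zeta(k). *)
Definition coprime_zeta (d : nat) : R :=
  \sum_(a : 'I_d.+1 | (0 < a)%N && coprime a d) hurwitz_zeta k (a%:R / d%:R).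

Lemma gcd_class_sum q g : (0 < q)%N -> (0 < g)%N -> (g %| q)%N ->
  \sum_(a : 'I_q.+1 | (0 < a)%N && (gcdn a q == g)) (hurwitz_zeta k (a%:R / q%:R) : R) =
  coprime_zeta (q %/ g).
Proof.
move=> q0 g0 /dvdnP[d qE]; subst q.
have d0 : (0 < d)%N by move: q0; rewrite muln_gt0 => /andP[].
rewrite /coprime_zeta mulnK //.
rewrite (reindex_onto (fun a : 'I_d.+1 => inord (a * g) : 'I_(d * g).+1)
                      (fun a : 'I_(d * g).+1 => inord (a %/ g) : 'I_d.+1)); last first.
  move=> a /andP[a0 /eqP ga]; apply: val_inj.
  have gda : (g %| a)%N by have := dvdn_gcdl a (d * g); rewrite ga.
  have ad : (a %/ g < d.+1)%N by rewrite ltnS leq_divLR // -ltnS.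
  by rewrite /= !inordK ?divnK // ?ltnS // inordK.
have v (a : 'I_d.+1) : (inord (a * g) : 'I_(d * g).+1) = (a * g)%N :> nat.
  by rewrite inordK // ltnS leq_mul2r -[(a <= d)%N]ltnS ltn_ord orbT.
apply: eq_big => [a|a _].
  rewrite v mulnK // inord_val eqxx andbT muln_gt0 g0 andbT.
  by rewrite -muln_gcdl -[g in (_ == g)]mul1n eqn_pmul2r.
rewrite v !natrM -mulf_div divff ?mulr1 // pnatr_eq0 -lt0n //.
Qed.

(** Moebius inversion as a strong induction: the sum over all a in 1..q is q^k zeta(k), and the
    class gcd(a, q) = g is the same kind of sum for q/g. The rational factor is Jordan's totient
    J_k(q). *)
Lemma coprime_zeta_rat q : (0 < q)%N -> ratmul (coprime_zeta q).
Proof.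
have [m] := ubnP q; elim: m q => // m IH q; rewrite ltnS => qm q0.
have tot : \sum_(a : 'I_q.+1 | (0 < a)%N) (hurwitz_zeta k (a%:R / q%:R) : R) = q%:R ^+ k * z1.
  rewrite big_mkcond big_ord_recl /= add0r -hurwitz_zeta_distr //.
  by apply: eq_bigr => i _; rewrite /bump /= natrD.
have part : \sum_(a : 'I_q.+1 | (0 < a)%N) (hurwitz_zeta k (a%:R / q%:R) : R) =
    \sum_(g : 'I_q.+1) \sum_(a : 'I_q.+1 | (0 < a)%N && (gcdn a q == g)) hurwitz_zeta k (a%:R / q%:R).
  rewrite (partition_big (fun a : 'I_q.+1 => inord (gcdn a q) : 'I_q.+1) predT) //=.
  apply: eq_bigr => g _; apply: eq_bigl => a; congr (_ && _).
  have h : (gcdn a q < q.+1)%N by rewrite ltnS dvdn_leq // dvdn_gcdr.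
  by apply/eqP/eqP => [<-|e]; [rewrite inordK | apply: val_inj; rewrite /= inordK].
have q1 : (1 < q.+1)%N by rewrite ltnS.
move: tot; rewrite part (bigD1 (Ordinal q1)) //=.
set rest := \sum_(g < q.+1 | g != Ordinal q1) _ => e.
have -> : coprime_zeta q = q%:R ^+ k * z1 - rest.
  by rewrite -e addrK.
have [r ->] : ratmul rest.
  apply: ratmul_sum => g ne.
  have [gq|gq] := boolP (g %| q)%N; last first.
    rewrite big1; first by exists 0; rewrite rmorph0 mul0r.
    by move=> a /andP[_ /eqP ga]; case/negP: gq; rewrite -ga dvdn_gcdr.
  have g0 : (0 < g)%N by apply: dvdn_gt0 gq.
  have g1 : (1 < g)%N.
    by rewrite ltn_neqAle g0 andbT eq_sym.
  rewrite gcd_class_sum //; apply: IH; last by rewrite divn_gt0 // dvdn_leq.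
  by apply: leq_trans qm; rewrite ltn_Pdiv.
exists (q%:R ^+ k - r); rewrite rmorphB rmorphXn /= ratr_nat; ring.
Qed.

Lemma Vgens_sum q : (0 < q)%N -> ~~ odd k -> exists2 r : rat, r != 0 &
  \sum_(y <- Vgens R k q) y = ratr r * z1%:C%C.
Proof.
move=> q0 kodd; have z10 : 0 < z1 by apply: (hurwitz_zeta_gt0 k_gt1).
(* Positivity of the block sum is what makes the rational factor nonzero. *)
suff [x [x0 [r rE] ->]] : exists x : R, [/\ 0 < x, ratmul x & \sum_(y <- Vgens R k q) y = x%:C%C].
  exists r; last by rewrite rE rmorphM /= fmorph_rat.
  by apply: contraTneq x0 => r0; rewrite rE r0 rmorph0 mul0r ltxx.
rewrite VgensE big_map /reps; case: (ltnP 2 q) => q2; last first.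
  rewrite big_seq1 /gval ltnNge q2 /= -signr_odd (negPf kodd) expr0.
  exists (if q == 2%N then hurwitz_zeta k (1 / 2) * (1 + 1) else z1 * (1 + 1)); split=> //.
    case: ifP => _; rewrite mulr_gt0 ?(hurwitz_zeta_gt0 k_gt1) //; lra.
  case: ifP => _; last by exists 2; rewrite ratr_nat mulrC.
  exists ((2 ^+ k - 1) * 2); rewrite (zeta_half R k_gt1).
  rewrite rmorphM rmorphB rmorphXn rmorph1 /= !ratr_nat; ring.
have q1 : (1 < q)%N by exact: ltnW.
exists (coprime_zeta q); split; last 1 first.
(* For even k the coefficient 1 extends to 1 on all units, so the block sum is the sum over all
   units. *)
- have := @half_reps_fold q q2 R k (fun=> 1) 1 (coprime1n q).
  move=> h; transitivity (\sum_(a <- half_reps q) 1 * (hsum k (((1 * a) %% q)%:R / q%:R) : R)%:C%C).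
    rewrite big_seq [RHS]big_seq; apply: eq_bigr => a au.
    have [a0 ah _] := half_reps_bounds au.
    by rewrite /gval q2 mul1r mul1n modn_small //; lia.
  rewrite h /coprime_zeta rmorph_sum [RHS]big_mkcond big_ord_recr /=.
  rewrite [X in _ + X]ifF ?addr0; last by rewrite /coprime gcdnn; lia.
  rewrite [LHS]big_mkcond; apply: eq_bigr => a _.
  case aq: (coprime a q); last by rewrite andbF.
  rewrite (coprime_ord_gt0 q1 aq) /= mul1n modn_small // /extend.
  by case: ifP => _; [rewrite mul1r | rewrite -signr_odd (negPf kodd) expr0 !mul1r].
- have o1 : (1 < q.+1)%N by exact: ltnW.
  rewrite /coprime_zeta (bigD1 (Ordinal o1)) ?coprime1n //= ltr_pwDl //.
    by apply: (hurwitz_zeta_gt0 k_gt1); rewrite divr_gt0 ?ltr0n.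
  apply: sumr_ge0 => a /andP[/andP[a0 _] _]; apply: (hurwitz_zeta_ge0 k_gt1).
  by rewrite divr_gt0 ?ltr0n.
exact: coprime_zeta_rat.
Qed.

End BlockSum.

(** * Dimensions *)

Lemma reps_uniq q : uniq (reps q).
Proof. by rewrite /reps; case: ifP => // _; rewrite filter_uniq // iota_uniq. Qed.

Lemma size_Vgens (R : realType) k q : size (Vgens R k q) = size (reps q).
Proof. by rewrite VgensE size_map. Qed.

Lemma size_reps_gt0 q : (0 < size (reps q))%N.
Proof.
rewrite /reps; case: (ltnP 2 q) => // q2; rewrite -has_predT; apply/hasP; exists 1%N => //.
by rewrite mem_filter coprime1n mem_iota /= andbT; lia.
Qed.

Lemma reps_small q : (q <= 2)%N -> reps q = [:: 1%N].
Proof. by rewrite /reps ltnNge => ->. Qed.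

Lemma lc_Vgens (R : realType) k q (c : seq R[i]) : lc c (Vgens R k q) =
  \sum_(a <- reps q) c`_(index a (reps q)) * (gval R k q a)%:C%C.
Proof.
rewrite /lc size_Vgens (big_nth 0%N) big_mkord; apply: eq_bigr => i _.
by rewrite VgensE (nth_map 0%N) // index_uniq // reps_uniq.
Qed.

Section Main.
Variables (R : realType) (k l : nat) (q : nat -> nat) (K : {pred R[i]}).
Local Notation C := R[i].
Hypothesis k_gt1 : (1 < k)%N.
Hypothesis q_gt0 : forall j, (j < l)%N -> (1 <= q j)%N.
Hypothesis q_coprime : forall i j, (i < l)%N -> (j < l)%N -> i != j -> coprime (q i) (q j).
Hypothesis K_field : number_field K.
Hypothesis K_cyclo : meets_cyclo_plus_in_Q K (\prod_(j < l) q j).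

Variable js : seq nat.
Hypothesis js_uniq : uniq js.
Hypothesis js_lt : all (fun j => j < l)%N js.
Let ss := [seq Vgens R k (q j) | j <- js].

Let K0 : 0 \in K. Proof. by case: K_field => -[]. Qed.

Let jsP i : (i < size js)%N -> (nth 0%N js i < l)%N.
Proof. by move=> h; apply: (allP js_lt); rewrite mem_nth. Qed.

Let nth_ss i : (i < size js)%N -> nth [::] ss i = Vgens R k (q (nth 0%N js i)).
Proof. by move=> h; rewrite (nth_map 0%N). Qed.

(** Stated for a sublist [js] of the blocks: all indices give the sum of the spaces, a singleton
    gives one space, and both dimensions follow from the same argument. *)
Lemma Vgens_relation cs : shape cs = shape ss -> all (all (fun x => x \in K)) cs ->
  \sum_(i < size ss) lc (nth [::] cs i) (nth [::] ss i) = 0 ->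
  forall i, (i < size js)%N -> (2 < q (nth 0%N js i))%N ->
  if odd k then is_true (all (pred1 0) (nth [::] cs i))
  else exists g, nth [::] cs i = nseq (size (nth [::] ss i)) g.
Proof.
move=> shc cK rel i ilt q2.
(* Positions become pairs (j, a); blocks outside [js] get coefficient 0, which yields a relation
   among all l blocks. *)
pose c j a : C := if j \in js then (nth [::] cs (index j js))`_(index a (reps (q j))) else 0.
have sz : size (nth [::] cs i) = size (half_reps (q (nth 0%N js i))).
  by rewrite (shape_nth i shc) nth_ss // size_Vgens /reps q2.
have cE i' : (i' < size js)%N -> forall a, c (nth 0%N js i') a =
    (nth [::] cs i')`_(index a (reps (q (nth 0%N js i')))).
  by move=> h a; rewrite /c mem_nth // index_uniq.
have cK' j a : c j a \in K.
  rewrite /c; case: ifP => // _.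
  have [h|h] := ltnP (index j js) (size cs); last by rewrite [nth [::] _ _]nth_default // nth_nil.
  have [h'|h'] := ltnP (index a (reps (q j))) (size (nth [::] cs (index j js)));
    last by rewrite nth_default.
  exact: (allP (allP cK _ (mem_nth [::] h)) _ (mem_nth 0 h')).
have rel' : \sum_(j < l) \sum_(a <- reps (q j)) c j a * (gval R k (q j) a)%:C%C = 0.
  rewrite -[RHS]rel.
  pose G j : C := \sum_(a <- reps (q j)) c j a * (gval R k (q j) a)%:C%C.
  transitivity (\sum_(j <- js) G j).
    rewrite -[LHS](big_mkord xpredT G) (bigID (mem js)) /= [X in _ + X]big1 ?addr0; last first.
      by move=> j /negPf nj; rewrite /G big1 // => a _; rewrite /c nj mul0r.
    rewrite -big_filter; apply: perm_big; apply: uniq_perm => //.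
      by rewrite filter_uniq // iota_uniq.
    move=> j; rewrite mem_filter mem_index_iota /= andb_idr // => /(allP js_lt) //.
  rewrite (big_nth 0%N) big_mkord size_map; apply: eq_bigr => i' _.
  rewrite nth_ss // lc_Vgens /G; apply: eq_bigr => a _; by rewrite cE.
have N0 : (0 < \prod_(j < l) q j)%N by rewrite prodn_gt0 // => j; apply: q_gt0.
have := block_relation k_gt1 q_gt0 N0 (fun j => @dvdn_big_prod l q j)
  (fun j0 b => @chinese_block l q j0 b q_coprime) K_field K_cyclo cK' rel' (jsP ilt) q2.
have cn t : (t < size (nth [::] cs i))%N -> exists2 a, a \in half_reps (q (nth 0%N js i)) &
    (nth [::] cs i)`_t = c (nth 0%N js i) a.
  rewrite sz => tl; exists (nth 0%N (half_reps (q (nth 0%N js i))) t); first by rewrite mem_nth.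
  have ru := reps_uniq (q (nth 0%N js i)).
  rewrite cE //; move: ru; rewrite /reps q2 => ru.
  by rewrite index_uniq.
case: ifP => _.
  by move=> h; apply/(all_nthP 0) => t /cn[a au ->]; apply/eqP; exact: h.
move=> [g h]; exists g; apply: (@eq_from_nth _ 0).
  by rewrite size_nseq (shape_nth i shc).
move=> t tl; have [a au ->] := cn t tl.
by rewrite nth_nseq -(shape_nth i shc) tl h.
Qed.

Lemma dimK_even : (0 < size js)%N -> ~~ odd k ->
  dimK K (flatten ss) = ((\sum_(j <- js) size (reps (q j))) - (size js).-1)%N.
Proof.
move=> s0 kodd.
have hr j : exists r : rat, (j < l)%N -> r != 0 /\
    \sum_(y <- Vgens R k (q j)) y = ratr r * (hurwitz_zeta k 1)%:C%C.
  case: (ltnP j l) => jl; last by exists 0.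
  by have [r r0 e] := Vgens_sum R k_gt1 (q_gt0 jl) kodd; exists r.
have [r rP] := choice hr.
rewrite (@dimK_flatten_line R K K_field ss (fun i => ratr (r (nth 0%N js i))) (hurwitz_zeta k 1)%:C%C);
  rewrite ?size_map //.
- congr (_ - _)%N; rewrite [RHS](big_nth 0%N) big_mkord; apply: eq_bigr => i _.
  by rewrite nth_ss // size_Vgens.
- by rewrite fmorph_eq0 gt_eqF // (hurwitz_zeta_gt0 k_gt1).
- by move=> i ilt; rewrite nth_ss // size_Vgens size_reps_gt0.
- move=> i ilt; split; first exact: number_field_ratr.
  by case: (rP _ (jsP ilt)) => r0 _; rewrite fmorph_eq0.
- by move=> i ilt; rewrite nth_ss //; case: (rP _ (jsP ilt)).
move=> cs shc cK rel i ilt.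
have [q2|q2] := ltnP 2 (q (nth 0%N js i)).
  by have := Vgens_relation shc cK; rewrite size_map => /(_ rel i ilt q2); rewrite (negPf kodd).
have := shape_nth i shc; rewrite nth_ss // size_Vgens reps_small //.
by case: (nth [::] cs i) => [|g [|]] // _; exists g.
Qed.

Lemma dimK_odd : odd k ->
  dimK K (flatten ss) = (\sum_(j <- js | 2 < q j) size (reps (q j)))%N.
Proof.
move=> kodd; rewrite (@dimK_flatten_free R K K_field ss (fun i => 2 < q (nth 0%N js i)))%N;
  rewrite ?size_map.
- rewrite [RHS](big_nth 0%N) big_mkord; apply: eq_bigr => i _.
  by rewrite nth_ss // size_Vgens.
- move=> i ilt; rewrite -leqNgt => q2; rewrite nth_ss // VgensE reps_small //=.
  by rewrite gval_small // /small_val kodd rmorph0 mulr0 eqxx.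
move=> cs shc cK rel i ilt q2.
by have := Vgens_relation shc cK; rewrite size_map => /(_ rel i ilt q2); rewrite kodd.
Qed.

End Main.

Lemma dimK_Vgens1 (R : realType) k (K : {pred R[i]}) : (1 < k)%N -> number_field K ->
  dimK K (Vgens R k 1) = ~~ odd k :> nat.
Proof.
move=> k1 KF; have -> : Vgens R k 1 = flatten [:: [:: (hurwitz_zeta k 1 * (1 + (-1) ^+ k))%:C%C]] by [].
case kodd: (odd k).
  rewrite (@dimK_flatten_free _ _ KF _ pred0) ?big_pred0 //.
  by case=> // _ _ /=; rewrite -signr_odd kodd expr1 subrr mulr0 eqxx.
have z0 : 0 < hurwitz_zeta k 1 :> R by apply: (hurwitz_zeta_gt0 k1).
rewrite (@dimK_flatten_line _ _ KF _ (fun=> 2) (hurwitz_zeta k 1)%:C%C) //=.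
- by rewrite big_ord_recl big_ord0.
- by rewrite fmorph_eq0 gt_eqF.
- by case.
- move=> j _; rewrite pnatr_eq0; split=> //.
  by case: KF => -[_ K1 KD _ _] _; apply: KD.
- case=> // _ /=; rewrite big_seq1 -signr_odd kodd expr0 rmorphM mulrC; congr (_ * _).
  by rewrite rmorphD rmorph1.
move=> cs; case: cs => [|[|g []] []] // _ _ _ [] // _; by exists g.
Qed.

Theorem theorem1p10 (R : realType) (l : nat) (q : nat -> nat) (k : nat)
    (K : {pred R[i]}) :
  (1 <= l)%N ->
  (forall j, (j < l)%N -> (1 <= q j)%N) ->
  (forall i j, (i < l)%N -> (j < l)%N -> i != j -> coprime (q i) (q j)) ->
  (1 < k)%N ->
  number_field K ->
  meets_cyclo_plus_in_Q K (\prod_(j < l) q j) ->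
  let D := dimK K (flatten [seq Vgens R k (q j) | j <- iota 0 l]) in
  [/\ (D%:Z = \sum_(j < l) (dimK K (Vgens R k (q j)))%:Z
              - (l%:Z - 1) * (dimK K (Vgens R k 1))%:Z),
      ((forall j, (j < l)%N -> (2 < q j)%N) ->
         D%:Q = \sum_(j < l) (totient (q j))%:Q / 2
                - (l%:Q - 1) / 2 * (1 + (-1) ^+ k)) &
      (q 0%N = 2%N -> (forall j, (0 < j < l)%N -> (2 < q j)%N) ->
         D%:Q = \sum_(1 <= j < l) (totient (q j))%:Q / 2
                - (l%:Q - 2) / 2 * (1 + (-1) ^+ k))].
Proof.
move=> l0 q0 qc k1 KF Kc; set D := dimK _ _; cbv zeta.
have jslt : all (fun j => j < l)%N (iota 0 l) by apply/allP => j; rewrite mem_iota.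
have big_iota (F : nat -> nat) : (\sum_(j <- iota 0 l) F j = \sum_(j < l) F j)%N.
  by rewrite -[l in iota 0 l]subn0 -/(index_iota 0 l) big_mkord.
pose n j := size (reps (q j)).
(* The dimension of a single block; for odd k a block with q_j <= 2 is spanned by 0. *)
pose w j : nat := (if odd k then (2 < q j) * n j else n j)%N.
have one j : (j < l)%N -> dimK K (Vgens R k (q j)) = w j.
  move=> jl; have jl' : all (fun i => i < l)%N [:: j] by rewrite /= jl.
  have -> : Vgens R k (q j) = flatten [seq Vgens R k (q i) | i <- [:: j]] by rewrite /= cats0.
  rewrite /w; case kodd: (odd k).
    by rewrite (dimK_odd k1 q0 qc KF Kc (js := [:: j])) // big_mkcond big_seq1;
      case: (2 < q j)%N; rewrite ?mul1n ?mul0n.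
  by rewrite (dimK_even k1 q0 qc KF Kc (js := [:: j])) ?kodd // big_seq1 subn0.
have DE : (D + (~~ odd k) * l.-1 = \sum_(j < l) w j)%N.
  rewrite /D /w; case kodd: (odd k) => /=.
    rewrite (dimK_odd k1 q0 qc KF Kc (iota_uniq 0 l)) // mul0n addn0 big_mkcond big_iota.
    by apply: eq_bigr => j _; case: ifP; rewrite ?mul1n ?mul0n.
  rewrite (dimK_even k1 q0 qc KF Kc (iota_uniq 0 l)) ?size_iota ?kodd // mul1n big_iota.
  rewrite subnK //; apply: (@leq_trans l); first exact: leq_pred.
  rewrite -[X in (X <= _)%N]card_ord -sum1_card; apply: leq_sum => j _; exact: size_reps_gt0.
(* The ring is left open because the conclusions are stated over the integers and over the
   rationals. *)
have DA (F : comRingType) :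
    D%:R = \sum_(j < l) (w j)%:R - (~~ odd k)%:R * (l%:R - 1) :> F.
  have := congr1 (fun m => m%:R : F) DE.
  by rewrite natrD natrM natr_sum -subn1 natrB // => <-; rewrite addrK.
have DQ : D%:Q = \sum_(j < l) (w j)%:Q - (~~ odd k)%:Q * (l%:Q - 1).
  by have := DA rat; under eq_bigr do rewrite pmulrn; rewrite !pmulrn.
have e2 : 1 + (-1) ^+ k = 2 * (~~ odd k)%:Q.
  by rewrite -signr_odd; case: (odd k).
have tot j : (2 < q j)%N -> (w j)%:Q = (totient (q j))%:Q / 2.
  move=> q2; rewrite /w q2 mul1n if_same /n /reps q2 -(size_half_reps q2) -addnn.
  by rewrite -!pmulrn natrD; field.
split.
- rewrite (eq_bigr (fun j : 'I_l => (w j)%:Z)); last by move=> j _; rewrite one.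
  rewrite dimK_Vgens1 // [X in _ - X]mulrC.
  apply: etrans (esym (natz D)) (etrans (DA int) _).
  by congr (_ - _ * (_ - _)); [apply: eq_bigr => j _ | | ]; exact: natz.
- move=> q2; rewrite DQ e2; rewrite (eq_bigr (fun j : 'I_l => (totient (q j))%:Q / 2)).
    by rewrite -(mulr_suml); field.
  by move=> j _; rewrite tot // q2.
move=> q02 q2; rewrite DQ e2 -(big_mkord xpredT (fun j => (w j)%:Q)) big_ltn //.
rewrite (eq_big_nat _ _ (F2 := fun j => (totient (q j))%:Q / 2)); last first.
  by move=> j jl; rewrite tot // q2.
(* The block of 2 has dimension 1 for even k and 0 for odd k, which turns l - 1 into l - 2. *)
have -> : (w 0%N)%:Q = (~~ odd k)%:Q.
  by rewrite /w q02 /= /n q02 /reps /=; case: (odd k).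
by field.
Qed.
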